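(* Let $\lambda\in(-\pi/2,\pi/2)$ and $p\in\mathcal{P}_\lambda$. Then for all $z\in\mathbb{D}$ $$\left|\frac{zp'(z)}{p(z)}\right|\le M(\lambda,|z|),$$ where $$M(\lambda,r)=\begin{cases}\dfrac{2r\cos\lambda}{1+r^2-2r|\sin\lambda|}, & r<|\tan(\lambda/2)|,\\[2mm] \dfrac{2r}{1-r^2}, & r\ge|\tan(\lambda/2)|.\end{cases}$$ Equality holds at a point $z_0=re^{i\theta}$, $0<r<1$, if and only if $p(z)=p_\lambda(xz)$, where $x=e^{i(\alpha-\theta)}$ with $\alpha$ satisfying $$\begin{cases}\alpha=\pi/2+\lambda, & \text{if } r<-\tan(\lambda/2),\\ \alpha=-\pi/2+\lambda, & \text{if } r<\tan(\lambda/2),\\ 2r\sin(\alpha-\lambda)=-(1+r^2)\sin\lambda, & \text{if } r\ge|\tan(\lambda/2)|.\end{cases}$$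
   Context: $\mathbb{D}$ is the open unit disc, $\mathcal{A}_0$ is the set of analytic functions $f$ on $\mathbb{D}$ with $f(0)=1$. $\mathcal{P}_\lambda=\{p\in\mathcal{A}_0:\ \operatorname{Re}(e^{i\lambda}p(z))>0 \text{ for all } z\in\mathbb{D}\}$, and $p_\lambda(z)=\dfrac{1+e^{-2i\lambda}z}{1-z}$. *)

(* Defs.v *)
From Stdlib Require Export Reals.
From Coquelicot Require Export Coquelicot.
Open Scope R_scope.

Definition unit_disc (z : C) : Prop := Cmod z < 1.

(* Analyticity on the unit disc: near every point of the disc, [f] is the sum
   of a convergent power series centred at that point.  The values of [f]
   outside the disc are irrelevant. *)
Definition analytic_on_disc (f : C -> C) : Prop :=
  forall c : C, unit_disc c ->
  exists (a : nat -> C) (rho : R), 0 < rho /\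
    forall z : C, Cmod (z - c) < rho ->
      @is_pseries C_AbsRing C_NormedModule a (z - c)%C (f z).

Definition class_A0 (f : C -> C) : Prop :=
  analytic_on_disc f /\ f (RtoC 0) = RtoC 1.

(* [expi t] is e^{it}. *)
Definition expi (t : R) : C := (cos t, sin t).

Definition class_P (lambda : R) (p : C -> C) : Prop :=
  class_A0 p /\
  forall z : C, unit_disc z -> 0 < Re (expi lambda * p z)%C.

Definition p_extremal (lambda : R) (z : C) : C :=
  ((1 + expi (- (2 * lambda)) * z) / (1 - z))%C.

Definition M (lambda r : R) : R :=
  if Rlt_dec r (Rabs (tan (lambda / 2)))
  then 2 * r * cos lambda / (1 + r ^ 2 - 2 * r * Rabs (sin lambda))
  else 2 * r / (1 - r ^ 2).

(* For 0 < r exactly one of the three premises holds. *)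
Definition extremal_angle (lambda r alpha : R) : Prop :=
  (r < - tan (lambda / 2) -> alpha = PI / 2 + lambda) /\
  (r < tan (lambda / 2) -> alpha = - PI / 2 + lambda) /\
  (Rabs (tan (lambda / 2)) <= r ->
     2 * r * sin (alpha - lambda) = - (1 + r ^ 2) * sin lambda).

(* Main.v *)
Require Import Defs.
From Stdlib Require Import Lra Lia Classical ClassicalEpsilon.

(** Put w z = e^(i lambda) p z.  This function maps the disc to the right
    half-plane, w 0 = e^(i lambda), and |z p' / p| = |z| |w'| / |w|.  The bound
    is the product of two sharp estimates.

    The Schwarz-Pick inequality for the half-plane, [half_plane_gradient],
    gives |w' z| <= 2 Re (w z) / (1 - |z|^2), so that
    |z p' / p| <= 2 r / (1 - r^2) * cos (arg (w z)) with r = |z|.  Schwarz-Pick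
    between z and 0, [half_plane_location], places w z in a Euclidean disc that
    depends only on lambda and r.  This disc meets the real axis if and only if
    r >= |tan (lambda / 2)|, and then the cosine is bounded by 1 only.
    Otherwise its maximum is attained at the point where a tangent from the
    origin touches the disc ([tangent_point_extremal]), with value
    cos lambda (1 - r^2) / (1 + r^2 - 2 r |sin lambda|).  The two cases are
    [max_cos_arg_bound] and they give the two formulas for M.

    Equality in the theorem is equality in both estimates.  In the first it
    forces (w z - w 0) / (w z + conj (w 0)) = k z with |k| = 1
    ([half_plane_gradient_rigidity]), i.e. p z = p_lambda (k z); in the second
    it fixes w at z0, hence k z0 = r e^(i alpha).  Conversely the modulus is
    computed for the extremal function ([extremal_derivative],
    [extremal_value]).

    Schwarz-Pick and its equality case rest on a maximum principle.  It is
    proved for functions that have Taylor jets of every order at each point of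
    the disc.  Sums of local power series are such functions
    ([analytic_smooth]), and this class, unlike the power series themselves, is
    easily seen to be stable under the products and quotients that are formed
    here.  The weak principle uses only a cubic Taylor remainder and
    compactness; the strong one follows from the Schwarz-Pick inequality
    itself. *)

(** * Taylor jets of complex functions *)

Definition near (c : C) (P : C -> Prop) : Prop :=
  exists d : R, 0 < d /\ forall z : C, Cmod (z - c) < d -> P z.

Lemma near_and (c : C) (P Q : C -> Prop) :
  near c P -> near c Q -> near c (fun z => P z /\ Q z).
Proof.
  intros [d1 [H1 K1]] [d2 [H2 K2]]. exists (Rmin d1 d2). split.
  - now apply Rmin_glb_lt.
  - intros z Hz. split; [apply K1 | apply K2]; eapply Rlt_le_trans; try exact Hz;
      [apply Rmin_l | apply Rmin_r].
Qed.

Lemma near_imp (c : C) (P Q : C -> Prop) :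
  (forall z, P z -> Q z) -> near c P -> near c Q.
Proof. intros H [d [Hd K]]. exists d. split; auto. Qed.

Lemma near_all (c : C) (P : C -> Prop) : (forall z, P z) -> near c P.
Proof. intros H. exists 1. split; [lra | auto]. Qed.

Lemma near_at (c : C) (P : C -> Prop) : near c P -> P c.
Proof.
  intros [d [Hd K]]. apply K. replace (c - c)%C with (RtoC 0) by ring.
  now rewrite Cmod_0.
Qed.

Lemma near_ball (c : C) (r : R) : 0 < r -> near c (fun z => Cmod (z - c) < r).
Proof. intros H. exists r. auto. Qed.

Lemma Cmod_sub_le (z c : C) : Cmod z <= Cmod c + Cmod (z - c).
Proof. replace z with (c + (z - c))%C at 1 by ring. apply Cmod_triangle. Qed.

Lemma Cmod_sub_sym (z c : C) : Cmod (z - c) = Cmod (c - z).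
Proof. replace (z - c)%C with (- (c - z))%C by ring. apply Cmod_opp. Qed.

Lemma unit_disc_near (c : C) : unit_disc c -> near c unit_disc.
Proof.
  unfold unit_disc. intros H. exists (1 - Cmod c). split; [lra |].
  intros z Hz. pose proof (Cmod_sub_le z c). lra.
Qed.

Lemma Csub_neq_0 (z a : C) : z <> a -> (z - a)%C <> 0.
Proof.
  intros H E. apply H. replace z with (z - a + a)%C by ring. rewrite E. ring.
Qed.

Lemma near_neq (c a : C) : c <> a -> near c (fun z => z <> a).
Proof.
  intros H. exists (Cmod (c - a)). split.
  - now apply Cmod_gt_0, Csub_neq_0.
  - intros z Hz E. subst z. rewrite Cmod_sub_sym in Hz. lra.
Qed.

(** [jet n f c] is an order-[n] Taylor expansion of [f] at [c] with remainder
    O((z - c)^n), written as iterated difference quotients.  In this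
    recursive form stability under sums, products, inverses and difference
    quotients costs one short induction each, which a direct treatment of
    convergent power series would not give. *)
Fixpoint jet (n : nat) (f : C -> C) (c : C) : Prop :=
  match n with
  | O => exists B : R, near c (fun z => Cmod (f z) <= B)
  | S m => exists g : C -> C,
      jet m g c /\ near c (fun z => f z = f c + (z - c) * g z)%C
  end.

Lemma jet_pred (n : nat) (f : C -> C) (c : C) : jet (S n) f c -> jet n f c.
Proof.
  revert f. induction n as [| n IH]; intros f [g [Hg K]].
  - destruct Hg as [B HB]. exists (Cmod (f c) + 1 * B).
    generalize (near_and _ _ _ (near_and _ _ _ K HB) (near_ball c 1 Rlt_0_1)).
    apply near_imp. intros z [[E H] H1]. rewrite E.
    eapply Rle_trans; [apply Cmod_triangle |]. apply Rplus_le_compat_l.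
    rewrite Cmod_mult. apply Rmult_le_compat; try apply Cmod_ge_0; lra.
  - exists g. split; [now apply IH | exact K].
Qed.

Lemma jet_one (n : nat) (f : C -> C) (c : C) : jet (S n) f c -> jet 1 f c.
Proof. induction n as [| n IH]; [auto |]. intros H. apply IH, jet_pred, H. Qed.

Lemma jet_near (n : nat) (f f' : C -> C) (c : C) :
  near c (fun z => f z = f' z) -> jet n f c -> jet n f' c.
Proof.
  intros E. destruct n as [| n].
  - intros [B HB]. exists B. generalize (near_and _ _ _ E HB). apply near_imp.
    intros z [<- H]. exact H.
  - intros [g [Hg K]]. exists g. split; [exact Hg |].
    pose proof (near_at _ _ E) as E0. simpl in E0.
    generalize (near_and _ _ _ E K). apply near_imp.
    intros z [<- H]. now rewrite <- E0.
Qed.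

Lemma jet_const (n : nat) (k c : C) : jet n (fun _ => k) c.
Proof.
  revert k. induction n as [| n IH]; intros k.
  - exists (Cmod k). apply near_all. intros; lra.
  - exists (fun _ => RtoC 0). split; [apply IH |]. apply near_all. intros z; ring.
Qed.

Lemma jet_id (n : nat) (c : C) : jet n (fun z => z) c.
Proof.
  apply jet_pred. exists (fun _ => RtoC 1). split; [apply jet_const |].
  apply near_all. intros z; ring.
Qed.

Lemma jet_plus (n : nat) (f g : C -> C) (c : C) :
  jet n f c -> jet n g c -> jet n (fun z => f z + g z)%C c.
Proof.
  revert f g. induction n as [| n IH]; intros f g.
  - intros [A HA] [B HB]. exists (A + B). generalize (near_and _ _ _ HA HB).
    apply near_imp. intros z [H1 H2]. eapply Rle_trans; [apply Cmod_triangle |]. lra.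
  - intros [F [HF KF]] [G [HG KG]]. exists (fun z => F z + G z)%C.
    split; [now apply IH |]. generalize (near_and _ _ _ KF KG).
    apply near_imp. intros z [E1 E2]. rewrite E1 at 1. rewrite E2 at 1. ring.
Qed.

(** With h = z - c, f = f0 + h F and g = g0 + h G, the first difference
    quotient of f g is f0 G + F g: this form keeps the factor g whole, so only
    jets of lower order of F, G and g enter. *)
Lemma jet_mult (n : nat) (f g : C -> C) (c : C) :
  jet n f c -> jet n g c -> jet n (fun z => f z * g z)%C c.
Proof.
  revert f g. induction n as [| n IH]; intros f g.
  - intros [A HA] [B HB]. exists (A * B). generalize (near_and _ _ _ HA HB).
    apply near_imp. intros z [H1 H2]. rewrite Cmod_mult.
    apply Rmult_le_compat; try apply Cmod_ge_0; assumption.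
  - intros Hf Hg. pose proof (jet_pred _ _ _ Hg) as Hg'.
    destruct Hf as [F [HF KF]]. destruct Hg as [G [HG KG]].
    exists (fun z => f c * G z + F z * g z)%C. split.
    + apply jet_plus; apply IH; auto. apply jet_const.
    + generalize (near_and _ _ _ KF KG). apply near_imp. intros z [E1 E2].
      rewrite E1 at 1. rewrite E2. ring.
Qed.

Lemma jet_continuous (f : C -> C) (c : C) (eps : R) :
  jet 1 f c -> 0 < eps -> near c (fun z => Cmod (f z - f c) < eps).
Proof.
  intros [g [[B HB] K]] He.
  assert (Hp : 0 < eps / (Rabs B + 1)).
  { apply Rdiv_lt_0_compat; [exact He |]. pose proof (Rabs_pos B). lra. }
  generalize (near_and _ _ _ (near_and _ _ _ K HB) (near_ball c _ Hp)).
  apply near_imp. intros z [[E H] H1]. rewrite E.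
  replace (f c + (z - c) * g z - f c)%C with ((z - c) * g z)%C by ring.
  rewrite Cmod_mult. pose proof (Rle_abs B) as HA. pose proof (Rabs_pos B).
  apply Rle_lt_trans with (Cmod (z - c) * (Rabs B + 1)).
  - apply Rmult_le_compat_l; [apply Cmod_ge_0 |]. lra.
  - apply Rlt_le_trans with (eps / (Rabs B + 1) * (Rabs B + 1)).
    + apply Rmult_lt_compat_r; lra.
    + right. field. lra.
Qed.

Lemma jet_away (f : C -> C) (c : C) :
  jet 1 f c -> f c <> 0 -> near c (fun z => Cmod (f c) / 2 < Cmod (f z)).
Proof.
  intros Hf H0. apply Cmod_gt_0 in H0.
  assert (H : 0 < Cmod (f c) / 2) by lra.
  generalize (jet_continuous f c _ Hf H). apply near_imp. intros z Hz.
  pose proof (Cmod_sub_le (f c) (f z)). rewrite Cmod_sub_sym in Hz. lra.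
Qed.

(** The difference quotient of 1/f is -(1/f0) g / f, again a product with
    1/f, so one order is lost only at the start, where continuity of f is used
    to keep 1/f bounded. *)
Lemma jet_inv (n : nat) (f : C -> C) (c : C) :
  jet (S n) f c -> f c <> 0 -> jet n (fun z => / f z)%C c.
Proof.
  revert f. induction n as [| n IH]; intros f Hf H0.
  - exists (/ (Cmod (f c) / 2)). generalize (jet_away f c Hf H0).
    apply near_imp. intros z Hz. pose proof (proj1 (Cmod_gt_0 _) H0).
    rewrite Cmod_inv.
    + apply Rinv_le_contravar; lra.
    + apply Cmod_gt_0. lra.
  - pose proof (IH f (jet_pred _ _ _ Hf) H0) as Hi.
    pose proof (jet_one _ _ _ Hf) as Hf1.
    destruct Hf as [g [Hg K]].
    exists (fun z => - / f c * (g z * / f z))%C. split.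
    + apply jet_mult; [apply jet_const |]. apply jet_mult; [| exact Hi].
      now apply jet_pred.
    + pose proof (jet_away f c Hf1 H0) as Ha.
      generalize (near_and _ _ _ K Ha). apply near_imp. intros z [E Hz].
      pose proof (Cmod_ge_0 (f c)).
      assert (Hn : f z <> 0) by (apply Cmod_gt_0; lra).
      assert (E2 : ((z - c) * g z = f z - f c)%C) by (rewrite E; ring).
      replace ((z - c) * (- / f c * (g z * / f z)))%C
        with (((z - c) * g z) * (- / f c * / f z))%C by ring.
      rewrite E2. field. split; assumption.
Qed.

(** Expansions of every order are required so that a difference quotient of
    such a function is again one, at the base point included. *)
Definition smooth_on_disc (f : C -> C) : Prop :=
  forall c : C, unit_disc c -> forall n : nat, jet n f c.

Lemma jet_opp (n : nat) (f : C -> C) (c : C) :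
  jet n f c -> jet n (fun z => - f z)%C c.
Proof.
  intros H. apply jet_near with (fun z => - (1) * f z)%C.
  - apply near_all. intros; ring.
  - apply jet_mult; [apply jet_const | exact H].
Qed.

Lemma jet_minus (n : nat) (f g : C -> C) (c : C) :
  jet n f c -> jet n g c -> jet n (fun z => f z - g z)%C c.
Proof. intros Hf Hg. apply (jet_plus n f (fun z => - g z)%C); auto using jet_opp. Qed.

(** [C_derive] is a limit along the horizontal line through [c] only; the
    difference quotient g is continuous at [c], so that limit is g c. *)
Lemma C_derive_jet (f g : C -> C) (c : C) :
  jet 1 g c -> near c (fun z => f z = f c + (z - c) * g z)%C ->
  C_derive f c = g c.
Proof.
  intros Hg K.
  assert (H : forall eps : R, 0 < eps ->
    near c (fun z => z <> c -> Cmod ((f z - f c) / (z - c) - g c) < eps)).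
  { intros eps He. generalize (near_and _ _ _ K (jet_continuous g c eps Hg He)).
    apply near_imp. intros z [E Hz] Hn.
    replace ((f z - f c) / (z - c))%C with (g z); [exact Hz |].
    rewrite E. field. now apply Csub_neq_0. }
  assert (P : forall eps : R, 0 < eps -> exists d : posreal, forall x : R,
    Rabs (x - fst c) < d -> x <> fst c ->
    Cmod ((f (x, snd c) - f c) / ((x, snd c) - c) - g c) < eps).
  { intros eps He. destruct (H eps He) as [d [Hd Kd]].
    exists (mkposreal d Hd). intros x Hx Hn. apply Kd.
    - replace ((x, snd c) - c)%C with (RtoC (x - fst c)).
      + now rewrite Cmod_R.
      + apply injective_projections; simpl; ring.
    - intros E. apply Hn. now rewrite <- E. }
  unfold C_derive, C_lim. rewrite (surjective_pairing (g c)).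
  f_equal.
  - etransitivity; [apply (f_equal real), (is_lim_unique _ _ (Finite (fst (g c)))) | reflexivity].
    apply is_lim_spec. intros eps.
    destruct (P eps (cond_pos eps)) as [d Kd]. exists d. intros x Hx Hn.
    eapply Rle_lt_trans; [| apply (Kd x Hx Hn)].
    eapply Rle_trans; [| apply Rmax_Cmod].
    eapply Rle_trans; [| apply Rmax_l]. apply Req_le. reflexivity.
  - etransitivity; [apply (f_equal real), (is_lim_unique _ _ (Finite (snd (g c)))) | reflexivity].
    apply is_lim_spec. intros eps.
    destruct (P eps (cond_pos eps)) as [d Kd]. exists d. intros x Hx Hn.
    eapply Rle_lt_trans; [| apply (Kd x Hx Hn)].
    eapply Rle_trans; [| apply Rmax_Cmod].
    eapply Rle_trans; [| apply Rmax_r]. apply Req_le. reflexivity.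
Qed.

(** Removable singularity: dividing f z - f a by z - a stays in the class,
    because near [a] the quotient, given the value f' a at [a], is the function
    provided by the jets of f. *)
Lemma smooth_quotient (f : C -> C) (a : C) :
  smooth_on_disc f -> unit_disc a ->
  exists g : C -> C, smooth_on_disc g /\ g a = C_derive f a /\
    forall z : C, (f z = f a + (z - a) * g z)%C.
Proof.
  intros Hf Ha.
  set (g := fun z => match excluded_middle_informative (z = a) with
                     | left _ => C_derive f a
                     | right _ => ((f z - f a) * / (z - a))%C end).
  assert (Hga : g a = C_derive f a).
  { unfold g. destruct (excluded_middle_informative (a = a)); tauto. }
  assert (Hgn : forall z, z <> a -> g z = ((f z - f a) * / (z - a))%C).
  { intros z Hz. unfold g. destruct (excluded_middle_informative (z = a)); tauto. }
  exists g. split; [| split; [exact Hga |]].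
  - intros c Hc. destruct (classic (c = a)) as [-> | Hn].
    + intros n. apply jet_pred.
      destruct (Hf a Ha (S (S n))) as [G [HG K]].
      pose proof (jet_one _ _ _ HG) as HG1.
      apply jet_near with G; [| exact HG].
      pose proof (C_derive_jet f G a HG1 K) as E.
      revert K. apply near_imp. intros z Ez.
      destruct (classic (z = a)) as [-> | Hz].
      * now rewrite Hga.
      * rewrite (Hgn z Hz). rewrite Ez. field. now apply Csub_neq_0.
    + intros n. apply jet_near with (fun z => (f z - f a) * / (z - a))%C.
      * generalize (near_neq c a Hn). apply near_imp. intros z Hz.
        now rewrite Hgn.
      * apply jet_mult.
        -- apply jet_minus; [now apply Hf | apply jet_const].
        -- apply jet_inv; [apply jet_minus; [apply jet_id | apply jet_const] |].
           now apply Csub_neq_0.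
  - intros z. destruct (classic (z = a)) as [-> | Hz].
    + ring.
    + rewrite (Hgn z Hz). field. now apply Csub_neq_0.
Qed.

Lemma C_series_close (u : nat -> C) (l : C) :
  @is_series C_AbsRing C_NormedModule u l ->
  forall eps : R, 0 < eps -> exists N : nat, forall n : nat, (N <= n)%nat ->
    Cmod (@sum_n C_NormedModule u n - l) < eps.
Proof.
  intros H eps He.
  assert (Hl : @locally_norm C_AbsRing C_NormedModule l (fun y => Cmod (y - l) < eps)).
  { exists (mkposreal eps He). intros y Hy. exact Hy. }
  apply locally_le_locally_norm in Hl.
  destruct (H _ Hl) as [N HN]. exists N. exact HN.
Qed.

Lemma C_series_terms_bounded (u : nat -> C) (l : C) :
  @is_series C_AbsRing C_NormedModule u l ->
  exists B : R, 0 <= B /\ forall k : nat, Cmod (u k) <= B.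
Proof.
  intros H. destruct (C_series_close u l H 1 Rlt_0_1) as [N HN].
  assert (Hfin : forall m, exists B, 0 <= B /\ forall k, (k <= m)%nat -> Cmod (u k) <= B).
  { induction m as [| m [B [HB IH]]].
    - exists (Cmod (u O)). split; [apply Cmod_ge_0 |]. intros k Hk.
      replace k with O by lia. lra.
    - exists (Rmax B (Cmod (u (S m)))). split.
      + eapply Rle_trans; [exact HB | apply Rmax_l].
      + intros k Hk. destruct (Nat.eq_dec k (S m)) as [-> | Hn].
        * apply Rmax_r.
        * eapply Rle_trans; [apply IH; lia | apply Rmax_l]. }
  destruct (Hfin N) as [B [HB HBk]]. exists (Rmax B 2). split.
  - eapply Rle_trans; [exact HB | apply Rmax_l].
  - intros k. destruct (Nat.le_gt_cases k N) as [Hk | Hk].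
    + eapply Rle_trans; [now apply HBk | apply Rmax_l].
    + eapply Rle_trans; [| apply Rmax_r]. destruct k as [| k]; [lia |].
      pose proof (HN (S k) ltac:(lia)) as H1. pose proof (HN k ltac:(lia)) as H2.
      rewrite sum_Sn in H1.
      set (t := @sum_n C_NormedModule u k) in *.
      change (Cmod (t + u (S k) - l)%C < 1) in H1. change (Cmod (t - l)%C < 1) in H2.
      replace (u (S k)) with ((t + u (S k) - l) - (t - l))%C by ring.
      eapply Rle_trans; [apply Cmod_triangle |]. rewrite Cmod_opp. lra.
Qed.

(** Convergence at a single point c + h with h <> 0 bounds the terms there;
    within distance |h|/2 of c they are then dominated by a geometric series. *)
Lemma pseries_bounded (f : C -> C) (a : nat -> C) (c : C) :
  near c (fun z => @is_pseries C_AbsRing C_NormedModule a (z - c)%C (f z)) ->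
  exists B : R, near c (fun z => Cmod (f z) <= B).
Proof.
  intros [d [Hd K]].
  assert (Hz0 : Cmod ((c + RtoC (d / 2)) - c) < d).
  { replace (c + RtoC (d / 2) - c)%C with (RtoC (d / 2)) by ring.
    rewrite Cmod_R, Rabs_pos_eq; lra. }
  destruct (C_series_terms_bounded _ _ (K _ Hz0)) as [B [HB HBk]].
  exists (2 * B + 1). exists (d / 4). split; [lra |]. intros z Hz.
  assert (Hz' : Cmod (z - c) < d) by lra.
  destruct (C_series_close _ _ (K z Hz') 1 Rlt_0_1) as [N HN].
  specialize (HN N (Nat.le_refl N)).
  assert (Hpow : forall (x : C) k, @pow_n C_Ring x k = (x ^ k)%C).
  { intros x k. induction k as [| k IHk]; [reflexivity |]. simpl. now rewrite IHk. }
  assert (Hterm : forall k, Cmod (@scal C_AbsRing C_NormedModule (pow_n (z - c)%C k) (a k))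
                            <= B * (1 / 2) ^ k).
  { intros k. specialize (HBk k).
    change (Cmod (@pow_n C_Ring (z - c)%C k * a k) <= B * (1 / 2) ^ k).
    change (Cmod (@pow_n C_Ring (c + RtoC (d / 2) - c)%C k * a k) <= B) in HBk.
    rewrite Hpow, Cmod_mult, Cmod_pow in HBk |- *.
    replace (c + RtoC (d / 2) - c)%C with (RtoC (d / 2)) in HBk by ring.
    rewrite Cmod_R, Rabs_pos_eq in HBk by lra.
    apply Rle_trans with ((1 / 2) ^ k * ((d / 2) ^ k * Cmod (a k))).
    - rewrite <- Rmult_assoc, <- Rpow_mult_distr.
      apply Rmult_le_compat_r; [apply Cmod_ge_0 |].
      apply pow_incr. split; [apply Cmod_ge_0 | lra].
    - rewrite Rmult_comm. apply Rmult_le_compat_r; [| exact HBk].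
      apply pow_le; lra. }
  assert (Hsum : forall n, Cmod (@sum_n C_NormedModule
     (fun k => @scal C_AbsRing C_NormedModule (pow_n (z - c)%C k) (a k)) n)
     <= 2 * B - B * (1 / 2) ^ n).
  { induction n as [| n IHn].
    - rewrite sum_O. eapply Rle_trans; [apply Hterm |]. simpl. lra.
    - rewrite sum_Sn. eapply Rle_trans; [apply Cmod_triangle |].
      pose proof (Hterm (S n)) as HT. simpl pow in *. lra. }
  specialize (Hsum N).
  pose proof (Cmod_sub_le (f z) (@sum_n C_NormedModule
     (fun k => @scal C_AbsRing C_NormedModule (pow_n (z - c)%C k) (a k)) N)) as HT.
  rewrite Cmod_sub_sym in HN.
  assert (0 <= B * (1 / 2) ^ N) by (apply Rmult_le_pos; [lra | apply pow_le; lra]).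
  apply Rlt_le. eapply Rle_lt_trans; [exact HT |].
  apply Rlt_le_trans with (Cmod (@sum_n C_NormedModule
     (fun k => @scal C_AbsRing C_NormedModule (pow_n (z - c)%C k) (a k)) N) + 1).
  - apply Rplus_lt_compat_l. exact HN.
  - lra.
Qed.

(** Removing the constant term and dividing by z - c shifts the coefficients,
    so the difference quotient of a power series is a power series; the
    induction then needs only local boundedness. *)
Lemma pseries_jet (n : nat) (f : C -> C) (a : nat -> C) (c : C) :
  near c (fun z => @is_pseries C_AbsRing C_NormedModule a (z - c)%C (f z)) ->
  jet n f c.
Proof.
  revert f a. induction n as [| n IH]; intros f a K.
  - exact (pseries_bounded f a c K).
  - assert (Hfc : f c = a O).
    { pose proof (near_at _ _ K) as H0. simpl in H0.
      replace (c - c)%C with (RtoC 0) in H0 by ring.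
      pose proof (@is_pseries_0 C_AbsRing C_NormedModule a) as H1.
      exact (filterlim_locally_unique _ _ _ H0 H1). }
    set (g := fun z => match excluded_middle_informative (z = c) with
                     | left _ => a 1%nat
                     | right _ => (/ (z - c) * (f z - a O))%C end).
    exists g. split.
    + apply (IH g (PS_decr_1 a)). revert K. apply near_imp. intros z Hz.
      unfold g. destruct (excluded_middle_informative (z = c)) as [-> | Hn].
      * replace (c - c)%C with (RtoC 0) by ring.
        exact (@is_pseries_0 C_AbsRing C_NormedModule (PS_decr_1 a)).
      * apply (@is_pseries_decr_1 C_AbsRing C_NormedModule a (z - c)%C (/ (z - c))%C (f z)).
        -- now apply Cinv_l, Csub_neq_0.
        -- exact Hz.
    + apply near_all. intros z. unfold g.
      destruct (excluded_middle_informative (z = c)) as [-> | Hn].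
      * ring.
      * rewrite Hfc. field. now apply Csub_neq_0.
Qed.

Lemma analytic_smooth (f : C -> C) : analytic_on_disc f -> smooth_on_disc f.
Proof.
  intros H c Hc n. destruct (H c Hc) as [a [rho [Hr K]]].
  apply (pseries_jet n f a c). exists rho. auto.
Qed.

(** * The maximum principle *)

Lemma Cmod_sqr_expand (a e : C) (A E : R) :
  Cmod a <= A -> Cmod e <= E -> Cmod a ^ 2 - 2 * A * E <= Cmod (a + e) ^ 2.
Proof.
  intros Ha He. pose proof (Cmod_ge_0 a). pose proof (Cmod_ge_0 e).
  pose proof (Cmod_ge_0 (a + e)).
  assert (H2 : Cmod a - Cmod e <= Cmod (a + e)).
  { pose proof (Cmod_triangle (a + e) (- e)) as T. rewrite Cmod_opp in T.
    replace (a + e + - e)%C with a in T by ring. lra. }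
  assert (Cmod a * Cmod e <= A * E) by (apply Rmult_le_compat; lra).
  destruct (Rle_lt_dec (Cmod a) (Cmod e)); nra.
Qed.

Lemma Cmod_plus_le (a b : C) (A B : R) :
  Cmod a <= A -> Cmod b <= B -> Cmod (a + b) <= A + B.
Proof. intros. eapply Rle_trans; [apply Cmod_triangle | lra]. Qed.

(** Parseval identity on the four points t, -t, it, -it: the cross terms of a
    quadratic polynomial cancel because the powers 1 and 2 of a fourth root of
    unity sum to 0.  It replaces the mean value over a circle. *)
Lemma quadratic_four_directions (a0 a1 a2 : C) (t : R) :
  let P := fun h : C => Cmod (a0 + h * a1 + h * h * a2) ^ 2 in
  P (RtoC t) + P (RtoC (- t)) + P (0, t) + P (0, - t) =
  4 * Cmod a0 ^ 2 + 4 * t ^ 2 * Cmod a1 ^ 2 + 4 * t ^ 4 * Cmod a2 ^ 2.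
Proof.
  intros P. unfold P. rewrite !Cmod2_alt.
  destruct a0, a1, a2. unfold Re, Im. simpl. ring.
Qed.

Lemma square_four_directions (c : C) (t : R) :
  Cmod (c + RtoC t) ^ 2 + Cmod (c + RtoC (- t)) ^ 2 + Cmod (c + (0, t)) ^ 2
  + Cmod (c + (0, - t)) ^ 2 = 4 * Cmod c ^ 2 + 4 * t ^ 2.
Proof. rewrite !Cmod2_alt. destruct c. unfold Re, Im. simpl. ring. Qed.

(** The term [eta * Cmod z ^ 2] makes the function strictly subharmonic: its
    mean over the four points c + t, c - t, c + it, c - it exceeds its value
    at c by at least eta t^2 - O(t^3). *)
Lemma no_interior_max (G : C -> C) (c : C) (eta d : R) :
  jet 3 G c -> 0 < eta -> 0 < d ->
  exists z : C, Cmod (z - c) < d /\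
    Cmod (G c) ^ 2 + eta * Cmod c ^ 2 < Cmod (G z) ^ 2 + eta * Cmod z ^ 2.
Proof.
  intros [g [[k [[m [[B HB] Km]] Kk]] Kg]] He Hd.
  pose proof (near_and _ _ _ (near_and _ _ _ HB Km) (near_and _ _ _ Kk Kg)) as [r [Hr K]].
  set (a0 := G c) in *. set (a1 := g c) in *. set (a2 := k c) in *.
  assert (HB0 : 0 <= B).
  { pose proof (near_at _ _ HB) as H. simpl in H. pose proof (Cmod_ge_0 (m c)). lra. }
  set (A := Cmod a0 + Cmod a1 + Cmod a2).
  assert (HA : 0 <= A).
  { unfold A. pose proof (Cmod_ge_0 a0). pose proof (Cmod_ge_0 a1).
    pose proof (Cmod_ge_0 a2). lra. }
  set (q := eta / (2 * A * B + 1)).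
  assert (Hden : 0 < 2 * A * B + 1) by nra.
  assert (Hq : 0 < q) by (apply Rdiv_lt_0_compat; assumption).
  set (t := Rmin (Rmin 1 q) (Rmin d r) / 2).
  assert (Ht : 0 < t /\ t < 1 /\ t < q /\ t < d /\ t < r).
  { assert (0 < Rmin (Rmin 1 q) (Rmin d r)).
    { repeat apply Rmin_glb_lt; lra. }
    pose proof (Rmin_l (Rmin 1 q) (Rmin d r)). pose proof (Rmin_r (Rmin 1 q) (Rmin d r)).
    pose proof (Rmin_l 1 q). pose proof (Rmin_r 1 q).
    pose proof (Rmin_l d r). pose proof (Rmin_r d r). unfold t. lra. }
  clearbody t. destruct Ht as [Ht0 [Ht1 [Htq [Htd Htr]]]].
  assert (Hqt : 2 * A * B * t < eta).
  { assert (q * (2 * A * B + 1) = eta) by (unfold q; field; lra).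
    assert (0 <= A * B) by (now apply Rmult_le_pos).
    apply Rlt_le_trans with (t * (2 * A * B + 1)); [lra |].
    rewrite <- H. apply Rmult_le_compat_r; lra. }
  assert (Hstep : forall h : C, Cmod h = t ->
    Cmod (a0 + h * a1 + h * h * a2) ^ 2 - 2 * A * (t ^ 3 * B) <= Cmod (G (c + h)%C) ^ 2).
  { intros h Hh. specialize (K (c + h)%C).
    replace (c + h - c)%C with h in K by ring.
    destruct (K ltac:(lra)) as [[Hm E3] [E2 E1]].
    replace (G (c + h)%C) with ((a0 + h * a1 + h * h * a2) + h * h * h * m (c + h))%C
      by (rewrite E1, E2, E3; ring).
    apply Cmod_sqr_expand.
    - unfold A. apply Cmod_plus_le; [apply Cmod_plus_le; [lra |] |].
      + rewrite Cmod_mult, Hh. pose proof (Cmod_ge_0 a1). nra.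
      + rewrite !Cmod_mult, Hh. pose proof (Cmod_ge_0 a2).
        assert (t * t <= 1) by nra. nra.
    - rewrite !Cmod_mult, Hh. replace (t ^ 3) with (t * t * t) by ring.
      apply Rmult_le_compat_l; [| exact Hm]. repeat apply Rmult_le_pos; lra. }
  assert (HI : forall s : R, Cmod (0, s) = Rabs s).
  { intros s. replace ((0, s) : C) with (Ci * RtoC s)%C
      by (apply injective_projections; simpl; ring).
    rewrite Cmod_mult, Cmod_Ci, Cmod_R. ring. }
  assert (N1 : Cmod (RtoC t) = t) by (rewrite Cmod_R, Rabs_pos_eq; lra).
  assert (N2 : Cmod (RtoC (- t)) = t) by (rewrite Cmod_R, Rabs_Ropp, Rabs_pos_eq; lra).
  assert (N3 : Cmod (0, t) = t) by (rewrite HI, Rabs_pos_eq; lra).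
  assert (N4 : Cmod (0, - t) = t) by (rewrite HI, Rabs_Ropp, Rabs_pos_eq; lra).
  apply NNPP. intros Hno.
  assert (Hle : forall h : C, Cmod h = t ->
    Cmod (G (c + h)%C) ^ 2 + eta * Cmod (c + h) ^ 2 <= Cmod a0 ^ 2 + eta * Cmod c ^ 2).
  { intros h Hh. apply Rnot_lt_le. intros Hlt. apply Hno. exists (c + h)%C.
    split; [| exact Hlt]. replace (c + h - c)%C with h by ring. lra. }
  pose proof (Hstep _ N1). pose proof (Hstep _ N2).
  pose proof (Hstep _ N3). pose proof (Hstep _ N4).
  pose proof (Hle _ N1). pose proof (Hle _ N2).
  pose proof (Hle _ N3). pose proof (Hle _ N4).
  pose proof (quadratic_four_directions a0 a1 a2 t) as Q. cbv zeta beta in Q.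
  pose proof (square_four_directions c t) as S4.
  assert (0 <= 4 * t ^ 2 * Cmod a1 ^ 2) by (pose proof (pow2_ge_0 (t * Cmod a1)); nra).
  assert (0 <= 4 * t ^ 4 * Cmod a2 ^ 2) by (pose proof (pow2_ge_0 (t ^ 2 * Cmod a2)); nra).
  assert (Hfin : 4 * (2 * A * (t ^ 3 * B)) < eta * (4 * t ^ 2)).
  { replace (4 * (2 * A * (t ^ 3 * B))) with ((2 * A * B * t) * (4 * t ^ 2)) by ring.
    apply Rmult_lt_compat_r; [| exact Hqt]. pose proof (pow_lt t 2 Ht0). lra. }
  assert (HS : eta * (Cmod (c + RtoC t) ^ 2 + Cmod (c + RtoC (- t)) ^ 2
     + Cmod (c + (0, t)) ^ 2 + Cmod (c + (0, - t)) ^ 2)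
     = eta * (4 * Cmod c ^ 2) + eta * (4 * t ^ 2)) by (rewrite S4; ring).
  lra.
Qed.

(** Compactness of the closed disc in the form: a property with a positive
    margin that holds locally holds with a uniform margin.  The compact set
    used is a square containing the disc; a point of the square outside the
    disc has a neighbourhood where nothing is required. *)
Lemma disc_compactness (rho : R) (P : R -> C -> Prop) :
  (forall d d' z, d <= d' -> P d' z -> P d z) ->
  (forall c : C, Cmod c <= rho -> exists d : R, 0 < d /\
     forall z : C, Cmod z <= rho -> Cmod (z - c) < d -> P d z) ->
  exists d : R, 0 < d /\ forall z : C, Cmod z <= rho -> P d z.
Proof.
  intros Hmono Hloc.
  assert (Hall : forall c : C, exists d : R, 0 < d /\
     forall z : C, Cmod z <= rho -> Cmod (z - c) < d -> P d z).
  { intros c. destruct (Rle_lt_dec (Cmod c) rho) as [Hc | Hc]; [now apply Hloc |].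
    exists (Cmod c - rho). split; [lra |]. intros z Hz Hzc.
    pose proof (Cmod_sub_le c z). rewrite Cmod_sub_sym in Hzc. lra. }
  assert (Hd : forall u v : R, { d : posreal |
     forall z : C, Cmod z <= rho -> Cmod (z - (u, v)) < 2 * d -> P d z }).
  { intros u v. apply constructive_indefinite_description.
    destruct (Hall (u, v)) as [d [Hd K]].
    assert (H2 : 0 < d / 2) by lra. exists (mkposreal _ H2). simpl.
    intros z Hz Hzc. apply Hmono with d; [lra |]. apply K; [exact Hz | lra]. }
  destruct (compactness_value_2d (- rho) rho (- rho) rho (fun u v => proj1_sig (Hd u v)))
    as [d Kd].
  exists d. split; [apply cond_pos |]. intros z Hz.
  pose proof (Rmax_Cmod z) as HM.
  pose proof (Rmax_l (Rabs (fst z)) (Rabs (snd z))).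
  pose proof (Rmax_r (Rabs (fst z)) (Rabs (snd z))).
  apply NNPP. intros HnP.
  apply (Kd (fst z) (snd z)).
  - apply Rabs_le_between. lra.
  - apply Rabs_le_between. lra.
  - intros [u [v [_ [_ [Hu [Hv Hdd]]]]]]. apply HnP.
    destruct (Hd u v) as [e Ke]. simpl in *.
    apply Hmono with e; [exact Hdd |]. apply Ke; [exact Hz |].
    replace (z - (u, v))%C with (RtoC (fst z - u) + Ci * RtoC (snd z - v))%C
      by (apply injective_projections; simpl; ring).
    eapply Rle_lt_trans; [apply Cmod_triangle |].
    rewrite Cmod_mult, Cmod_Ci, !Cmod_R. lra.
Qed.

(** If |G z1| > 1, then u = |G|^2 + eta |z|^2 with eta small is larger at z1
    than on the boundary of a disc on which the hypothesis bounds G.  The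
    supremum of u over this disc is not attained: not inside, by
    [no_interior_max], and not on the boundary.  Compactness then puts u
    below its supremum by a uniform margin, which is absurd. *)
Lemma maximum_principle (G : C -> C) :
  smooth_on_disc G ->
  (forall eta : R, 0 < eta -> exists rho : R, rho < 1 /\
     forall z : C, rho <= Cmod z -> unit_disc z -> Cmod (G z) ^ 2 <= 1 + eta) ->
  forall z : C, unit_disc z -> Cmod (G z) <= 1.
Proof.
  intros HG Hb z1 Hz1. apply Rnot_lt_le. intros Hlt.
  set (eta := (Cmod (G z1) ^ 2 - 1) / 3).
  assert (Heta : 0 < eta) by (unfold eta; nra).
  destruct (Hb eta Heta) as [rho [Hrho Hbd]].
  assert (Hz1r : Cmod z1 < rho).
  { apply Rnot_le_lt. intros H. pose proof (Hbd z1 H Hz1).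
    unfold eta in *. lra. }
  set (u := fun z => Cmod (G z) ^ 2 + eta * Cmod z ^ 2).
  assert (Hcont : forall c, Cmod c <= rho -> forall e, 0 < e ->
     exists d, 0 < d /\ forall z, Cmod (z - c) < d -> u z < u c + e).
  { intros c Hc e He.
    assert (Huc : unit_disc c) by (unfold unit_disc; lra).
    set (A := 2 * Cmod (G c) + 1 + eta * (2 * Cmod c + 1)).
    pose proof (Cmod_ge_0 (G c)). pose proof (Cmod_ge_0 c).
    assert (HA : 0 < A) by (unfold A; nra).
    set (s := Rmin 1 (e / A)).
    assert (Hs : 0 < s).
    { apply Rmin_glb_lt; [lra |]. now apply Rdiv_lt_0_compat. }
    assert (Hs1 : s <= 1) by apply Rmin_l.
    assert (HsA : s * A <= e).
    { apply Rle_trans with (e / A * A).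
      - apply Rmult_le_compat_r; [lra | apply Rmin_r].
      - right. field. lra. }
    pose proof (near_and _ _ _ (jet_continuous G c s (HG c Huc 1%nat) Hs) (near_ball c s Hs))
      as [d [Hd K]].
    exists d. split; [exact Hd |]. intros z Hz. destruct (K z Hz) as [K1 K2].
    assert (Hsq : forall x y w : R, 0 <= x -> 0 <= y -> x <= y + w -> 0 <= w -> w < s ->
       x ^ 2 < y ^ 2 + (2 * y + 1) * s).
    { intros x y w Hx Hy Hxy Hw Hws.
      assert (x ^ 2 <= (y + w) ^ 2) by (apply pow_incr; lra). nra. }
    pose proof (Hsq _ _ _ (Cmod_ge_0 (G z)) (Cmod_ge_0 (G c)) (Cmod_sub_le _ _)
      (Cmod_ge_0 _) K1) as S1.
    pose proof (Hsq _ _ _ (Cmod_ge_0 z) (Cmod_ge_0 c) (Cmod_sub_le _ _)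
      (Cmod_ge_0 _) K2) as S2.
    assert (eta * Cmod z ^ 2 < eta * (Cmod c ^ 2 + (2 * Cmod c + 1) * s))
      by (apply Rmult_lt_compat_l; assumption).
    unfold u. unfold A in HsA. lra. }
  assert (Hu0 : forall z, 0 <= u z).
  { intros z. unfold u. pose proof (pow2_ge_0 (Cmod (G z))).
    pose proof (pow2_ge_0 (Cmod z)). nra. }
  set (V := fun x => exists z, Cmod z <= rho /\ x = u z).
  assert (Hbound : bound V).
  { (* the margin d bounds u by 1/d; this form is monotone in d without a sign condition *)
    destruct (disc_compactness rho (fun d z => d * u z <= 1)) as [d [Hd Kd]].
    - intros d d' z Hdd H. eapply Rle_trans; [| exact H].
      apply Rmult_le_compat_r; [apply Hu0 | exact Hdd].
    - intros c Hc. destruct (Hcont c Hc 1 Rlt_0_1) as [d [Hd K]].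
      pose proof (Hu0 c) as Hc0.
      assert (Hi : 0 < / (u c + 1)) by (apply Rinv_0_lt_compat; lra).
      exists (Rmin d (/ (u c + 1))). split; [now apply Rmin_glb_lt |].
      intros z Hz Hzc. pose proof (Rmin_l d (/ (u c + 1))).
      apply Rle_trans with (/ (u c + 1) * (u c + 1)).
      + apply Rmult_le_compat; [| apply Hu0 | apply Rmin_r |].
        * apply Rlt_le. now apply Rmin_glb_lt.
        * apply Rlt_le, K. lra.
      + right. field. lra.
    - exists (/ d). intros x [z [Hz ->]]. apply Rmult_le_reg_l with d; [exact Hd |].
      rewrite Rinv_r by lra. now apply Kd. }
  destruct (completeness V Hbound) as [S [HS1 HS2]].
  { exists (u z1), z1. split; [lra | reflexivity]. }
  assert (HSu : forall z, Cmod z <= rho -> u z <= S).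
  { intros z Hz. apply HS1. exists z. auto. }
  assert (HS0 : 1 + 3 * eta <= S).
  { pose proof (HSu z1 ltac:(lra)) as H. unfold u in H.
    pose proof (pow2_ge_0 (Cmod z1)). unfold eta in *. nra. }
  assert (Hstrict : forall c, Cmod c <= rho -> u c < S).
  { intros c Hc. destruct (Req_dec (Cmod c) rho) as [E | Hn].
    - assert (Huc : unit_disc c) by (unfold unit_disc; lra).
      pose proof (Hbd c ltac:(lra) Huc). unfold u.
      pose proof (Cmod_ge_0 c). assert (Cmod c ^ 2 <= 1) by nra. nra.
    - assert (Huc : unit_disc c) by (unfold unit_disc; lra).
      destruct (no_interior_max G c eta (rho - Cmod c) (HG c Huc 3%nat) Heta ltac:(lra))
        as [z [Hz Huz]].
      pose proof (Cmod_sub_le z c).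
      eapply Rlt_le_trans; [exact Huz |]. apply HSu. lra. }
  destruct (disc_compactness rho (fun d z => u z <= S - d)) as [d [Hd Kd]].
  - intros d d' z Hdd H. lra.
  - intros c Hc. pose proof (Hstrict c Hc) as Hsc.
    destruct (Hcont c Hc ((S - u c) / 2) ltac:(lra)) as [d [Hd K]].
    exists (Rmin d ((S - u c) / 2)). split; [apply Rmin_glb_lt; lra |].
    intros z Hz Hzc.
    pose proof (Rmin_l d ((S - u c) / 2)). pose proof (Rmin_r d ((S - u c) / 2)).
    pose proof (K z ltac:(lra)). lra.
  - assert (S <= S - d); [| lra]. apply HS2. intros x [z [Hz ->]]. now apply Kd.
Qed.

(** * The Schwarz-Pick inequality for the half-plane and its equality case *)

Lemma C_neq_0_of_Re (u : C) : 0 < Re u -> u <> 0.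
Proof. intros H E. rewrite E in H. simpl in H. lra. Qed.

Lemma Cmod_disc_identity (a z : C) :
  Cmod (1 - Cconj a * z) ^ 2 - Cmod (z - a) ^ 2 = (1 - Cmod a ^ 2) * (1 - Cmod z ^ 2).
Proof. rewrite !Cmod2_alt. destruct a, z. unfold Re, Im. simpl. ring. Qed.

Lemma Cmod_half_plane_identity (u v : C) :
  Cmod (u + Cconj v) ^ 2 - Cmod (u - v) ^ 2 = 4 * Re u * Re v.
Proof. rewrite !Cmod2_alt. destruct u, v. unfold Re, Im. simpl. ring. Qed.

Lemma Cmod_lt_1_sqr (z : C) : unit_disc z -> Cmod z ^ 2 < 1.
Proof. unfold unit_disc. intros H. pose proof (Cmod_ge_0 z). nra. Qed.

Lemma disc_denominator (a z : C) :
  unit_disc a -> unit_disc z -> Cmod (z - a) < Cmod (1 - Cconj a * z).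
Proof.
  intros Ha Hz. pose proof (Cmod_disc_identity a z) as E.
  pose proof (Cmod_lt_1_sqr _ Ha). pose proof (Cmod_lt_1_sqr _ Hz).
  pose proof (Cmod_ge_0 (z - a)). pose proof (Cmod_ge_0 (1 - Cconj a * z)).
  assert (0 < (1 - Cmod a ^ 2) * (1 - Cmod z ^ 2)) by (apply Rmult_lt_0_compat; lra).
  apply Rnot_le_lt. intros Hle.
  assert (Cmod (1 - Cconj a * z) ^ 2 <= Cmod (z - a) ^ 2) by (apply pow_incr; lra).
  lra.
Qed.

Lemma half_plane_sub_le (u v : C) :
  0 < Re u -> 0 < Re v -> Cmod (u - v) <= Cmod (u + Cconj v).
Proof.
  intros Hu Hv. pose proof (Cmod_half_plane_identity u v).
  assert (0 < Re u * Re v) by (now apply Rmult_lt_0_compat).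
  pose proof (Cmod_ge_0 (u - v)). pose proof (Cmod_ge_0 (u + Cconj v)).
  apply Rnot_lt_le. intros Hlt. nra.
Qed.

(** G is the quotient of the Cayley transform (w z - w a) / (w z + conj (w a))
    by the Blaschke factor (z - a) / (1 - conj a z).  The first has modulus at
    most 1 and the second tends to modulus 1 at the unit circle, so the
    maximum principle gives |G| <= 1.  G is kept in the statement because the
    equality cases are read off from it; at z = a it carries the derivative. *)
Lemma schwarz_pick (w : C -> C) (a : C) :
  smooth_on_disc w -> (forall z, unit_disc z -> 0 < Re (w z)) -> unit_disc a ->
  exists G : C -> C, smooth_on_disc G /\
    (forall z, unit_disc z -> Cmod (G z) <= 1) /\
    (forall z, unit_disc z ->
       ((w z - w a) * (1 - Cconj a * z) = G z * ((z - a) * (w z + Cconj (w a))))%C) /\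
    (G a * RtoC (2 * Re (w a)) = C_derive w a * RtoC (1 - Cmod a ^ 2))%C.
Proof.
  intros Hw Hpos Ha.
  destruct (smooth_quotient w a Hw Ha) as [q [Hq [Hqa Hqz]]].
  assert (Hden : forall z, unit_disc z -> (w z + Cconj (w a))%C <> 0).
  { intros z Hz. apply C_neq_0_of_Re. pose proof (Hpos z Hz). pose proof (Hpos a Ha).
    destruct (w z), (w a). unfold Re in *. simpl in *. lra. }
  set (G := fun z => (q z * ((1 - Cconj a * z) * / (w z + Cconj (w a))))%C).
  assert (HGz : forall z, unit_disc z ->
       ((w z - w a) * (1 - Cconj a * z) = G z * ((z - a) * (w z + Cconj (w a))))%C).
  { intros z Hz. unfold G. rewrite (Hqz z) at 1. field. now apply Hden. }
  assert (HG : smooth_on_disc G).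
  { intros c Hc n. unfold G.
    apply jet_mult; [now apply Hq |]. apply jet_mult.
    - apply jet_minus; [apply jet_const |].
      apply jet_mult; [apply jet_const | apply jet_id].
    - apply (jet_inv n (fun z => w z + Cconj (w a))%C); [| now apply Hden].
      apply jet_plus; [now apply Hw | apply jet_const]. }
  assert (Hmod : forall z, unit_disc z ->
    Cmod (G z) * Cmod (z - a) <= Cmod (1 - Cconj a * z)).
  { intros z Hz. pose proof (half_plane_sub_le (w z) (w a) (Hpos z Hz) (Hpos a Ha)) as H.
    assert (Hp : 0 < Cmod (w z + Cconj (w a))) by (apply Cmod_gt_0; now apply Hden).
    apply Rmult_le_reg_r with (Cmod (w z + Cconj (w a))); [exact Hp |].
    rewrite Rmult_assoc, <- !Cmod_mult, <- HGz by exact Hz.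
    rewrite !Cmod_mult, Rmult_comm.
    apply Rmult_le_compat_l; [apply Cmod_ge_0 | exact H]. }
  exists G. split; [exact HG |]. split; [| split; [exact HGz |]].
  - apply maximum_principle; [exact HG |]. intros eta Heta.
    set (d := 1 - Cmod a). assert (Hd : 0 < d) by (unfold d, unit_disc in *; lra).
    pose proof (Cmod_ge_0 a) as Ha0.
    (* |z - a| >= d/2 and 1 - |z|^2 <= 2 e when |z| >= 1 - e, whence the second bound on e *)
    set (e := Rmin (d / 2) (eta * d ^ 2 / 8)).
    assert (Hed : 0 < eta * d ^ 2 / 8).
    { pose proof (pow_lt d 2 Hd). nra. }
    assert (He : 0 < e) by (apply Rmin_glb_lt; lra).
    assert (He1 : e <= d / 2) by apply Rmin_l.
    assert (He2 : e <= eta * d ^ 2 / 8) by apply Rmin_r.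
    exists (1 - e). split; [lra |]. intros z Hz1 Hz.
    pose proof (Cmod_sub_le z a) as Hza.
    assert (Hlow : d / 2 <= Cmod (z - a)) by (unfold d in *; lra).
    pose proof (Hmod z Hz) as Hm. pose proof (Cmod_disc_identity a z) as E.
    assert (Hrhs : (1 - Cmod a ^ 2) * (1 - Cmod z ^ 2) <= eta * Cmod (z - a) ^ 2).
    { pose proof (Cmod_lt_1_sqr _ Ha). pose proof (Cmod_lt_1_sqr _ Hz).
      unfold unit_disc in Hz.
      assert (1 - Cmod z ^ 2 <= 2 * e) by nra.
      assert (d ^ 2 / 4 <= Cmod (z - a) ^ 2) by nra.
      assert (eta * (d ^ 2 / 4) <= eta * Cmod (z - a) ^ 2)
        by (apply Rmult_le_compat_l; lra).
      pose proof (pow2_ge_0 (Cmod a)).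
      assert ((1 - Cmod a ^ 2) * (1 - Cmod z ^ 2) <= 1 * (1 - Cmod z ^ 2))
        by (apply Rmult_le_compat_r; lra).
      lra. }
    assert (Hsq : (Cmod (G z) * Cmod (z - a)) ^ 2 <= Cmod (1 - Cconj a * z) ^ 2).
    { apply pow_incr. split; [apply Rmult_le_pos; apply Cmod_ge_0 | exact Hm]. }
    rewrite Rpow_mult_distr in Hsq.
    apply Rmult_le_reg_r with (Cmod (z - a) ^ 2); [apply pow_lt; lra |]. lra.
  - unfold G. rewrite Hqa.
    replace (RtoC (2 * Re (w a))) with (w a + Cconj (w a))%C
      by (apply injective_projections; simpl; unfold Re; ring).
    replace (1 - Cconj a * a)%C with (RtoC (1 - Cmod a ^ 2)).
    + field. now apply Hden.
    + rewrite RtoC_minus, Cmod2_conj. ring.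
Qed.

(** The function q = 1 - G conj (G c) has nonnegative real part and vanishes
    at c.  Schwarz-Pick for q + e at c gives
    |q z| |1 - conj c z| <= |z - c| |q z + 2 e|; letting e tend to 0 leaves
    |q z| |1 - conj c z| <= |z - c| |q z|, and |z - c| < |1 - conj c z| forces
    q z = 0. *)
Lemma strong_maximum_principle (G : C -> C) (c : C) :
  smooth_on_disc G -> (forall z, unit_disc z -> Cmod (G z) <= 1) ->
  unit_disc c -> Cmod (G c) = 1 ->
  forall z, unit_disc z -> G z = G c.
Proof.
  intros HG Hb Hc Hc1 z Hz.
  set (q := fun z => (1 - G z * Cconj (G c))%C).
  assert (Hcc : (G c * Cconj (G c))%C = RtoC 1).
  { rewrite <- Cmod2_conj, Hc1. f_equal. ring. }
  assert (Hqc : q c = RtoC 0) by (unfold q; rewrite Hcc; ring).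
  assert (Hq : smooth_on_disc q).
  { intros x Hx n. apply jet_minus; [apply jet_const |].
    apply jet_mult; [now apply HG | apply jet_const]. }
  assert (Hre : forall x, unit_disc x -> 0 <= Re (q x)).
  { intros x Hx. pose proof (re_le_Cmod (G x * Cconj (G c))) as H.
    rewrite Cmod_mult, Cmod_conj, Hc1 in H. pose proof (Hb x Hx).
    pose proof (Rle_abs (Re (G x * Cconj (G c)))).
    replace (Re (q x)) with (1 - Re (G x * Cconj (G c)))
      by (unfold q, Re; simpl; ring). lra. }
  assert (Heps : forall e, 0 < e ->
    Cmod (q z) * Cmod (1 - Cconj c * z) <= Cmod (z - c) * (Cmod (q z) + 2 * e)).
  { intros e He.
    destruct (schwarz_pick (fun x => q x + RtoC e)%C c) as [F [_ [HF [HFz _]]]].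
    - intros x Hx n. apply jet_plus; [now apply Hq | apply jet_const].
    - intros x Hx. pose proof (Hre x Hx).
      replace (Re (q x + RtoC e)) with (Re (q x) + e) by (unfold Re; simpl; ring). lra.
    - exact Hc.
    - specialize (HFz z Hz). rewrite Hqc in HFz.
      replace (q z + e - (0 + e))%C with (q z) in HFz by ring.
      replace (q z + e + Cconj (0 + e))%C with (q z + RtoC (2 * e))%C in HFz
        by (apply injective_projections; simpl; ring).
      rewrite <- Cmod_mult, HFz, !Cmod_mult.
      rewrite <- (Rmult_1_l (Cmod (z - c) * (Cmod (q z) + 2 * e))).
      apply Rmult_le_compat; [apply Cmod_ge_0 | | now apply HF |].
      + apply Rmult_le_pos; apply Cmod_ge_0.
      + apply Rmult_le_compat_l; [apply Cmod_ge_0 |].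
        apply Cmod_plus_le; [lra |]. rewrite Cmod_R, Rabs_pos_eq; lra. }
  assert (H0 : Cmod (q z) = 0).
  { pose proof (disc_denominator c z Hc Hz) as Hd.
    pose proof (Cmod_ge_0 (q z)) as Hq0. pose proof (Cmod_ge_0 (z - c)) as Hz0.
    apply NNPP. intros Hn.
    assert (Hgap : 0 < Cmod (q z) * (Cmod (1 - Cconj c * z) - Cmod (z - c)))
      by (apply Rmult_lt_0_compat; lra).
    set (g := Cmod (q z) * (Cmod (1 - Cconj c * z) - Cmod (z - c))) in *.
    set (e := g / (2 * (Cmod (z - c) + 1))).
    assert (He : 0 < e) by (apply Rdiv_lt_0_compat; lra).
    pose proof (Heps e He) as K.
    assert (e * (2 * (Cmod (z - c) + 1)) = g) by (unfold e; field; lra).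
    unfold g in *. nra. }
  apply Cmod_eq_0 in H0. unfold q in H0.
  assert (E : (G z * Cconj (G c))%C = RtoC 1).
  { replace (G z * Cconj (G c))%C with (1 - (1 - G z * Cconj (G c)))%C by ring.
    rewrite H0. ring. }
  replace (G z) with (G z * (G c * Cconj (G c)))%C by (rewrite Hcc; ring).
  replace (G z * (G c * Cconj (G c)))%C with (G z * Cconj (G c) * G c)%C by ring.
  rewrite E. ring.
Qed.

Lemma unit_disc_0 : unit_disc 0.
Proof. unfold unit_disc. rewrite Cmod_0. lra. Qed.

Lemma half_plane_gradient (w : C -> C) (a : C) :
  smooth_on_disc w -> (forall z, unit_disc z -> 0 < Re (w z)) -> unit_disc a ->
  Cmod (C_derive w a) * (1 - Cmod a ^ 2) <= 2 * Re (w a).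
Proof.
  intros Hw Hpos Ha. destruct (schwarz_pick w a Hw Hpos Ha) as [G [_ [HG [_ HGa]]]].
  apply (f_equal Cmod) in HGa. rewrite !Cmod_mult, !Cmod_R in HGa.
  pose proof (Hpos a Ha). pose proof (Cmod_lt_1_sqr _ Ha). pose proof (HG a Ha).
  rewrite !Rabs_pos_eq in HGa by lra. rewrite <- HGa. nra.
Qed.

Lemma half_plane_location (w : C -> C) (z : C) :
  smooth_on_disc w -> (forall z, unit_disc z -> 0 < Re (w z)) -> unit_disc z ->
  Cmod (w z - w 0) <= Cmod z * Cmod (w z + Cconj (w 0)).
Proof.
  intros Hw Hpos Hz.
  destruct (schwarz_pick w 0 Hw Hpos unit_disc_0) as [G [_ [HG [HGz _]]]].
  specialize (HGz z Hz). specialize (HG z Hz).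
  replace (1 - Cconj 0 * z)%C with (RtoC 1) in HGz
    by (apply injective_projections; simpl; ring).
  replace ((w z - w 0) * 1)%C with (w z - w 0)%C in HGz by ring.
  replace (z - 0)%C with z in HGz by ring.
  rewrite HGz, !Cmod_mult. rewrite <- (Rmult_1_l (Cmod z * _)) at 2.
  apply Rmult_le_compat_r; [| exact HG]. apply Rmult_le_pos; apply Cmod_ge_0.
Qed.

(** Equality means that the Schwarz-Pick quotient G based at a has modulus 1
    at a, so it is constant.  Its value at 0 then says that w a lies on the
    boundary of the disc allowed by Schwarz-Pick based at 0, i.e. that the
    quotient F based at 0 has modulus 1 at a.  Hence F is a constant k too,
    and the identity that defines F is the conclusion. *)
Lemma half_plane_gradient_rigidity (w : C -> C) (a : C) :
  smooth_on_disc w -> (forall z, unit_disc z -> 0 < Re (w z)) -> unit_disc a -> a <> 0 ->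
  Cmod (C_derive w a) * (1 - Cmod a ^ 2) = 2 * Re (w a) ->
  exists k : C, Cmod k = 1 /\ forall z, unit_disc z ->
    (w z - w 0 = k * z * (w z + Cconj (w 0)))%C.
Proof.
  intros Hw Hpos Ha Ha0 Heq.
  destruct (schwarz_pick w a Hw Hpos Ha) as [G [HGs [HG [HGz HGa]]]].
  destruct (schwarz_pick w 0 Hw Hpos unit_disc_0) as [F [HFs [HF [HFz _]]]].
  pose proof (Hpos a Ha) as Hpa. pose proof (Hpos 0 unit_disc_0) as Hp0.
  pose proof (Cmod_lt_1_sqr _ Ha) as Ha1.
  assert (HGa1 : Cmod (G a) = 1).
  { apply (f_equal Cmod) in HGa. rewrite !Cmod_mult, !Cmod_R in HGa.
    rewrite !Rabs_pos_eq in HGa by lra. rewrite Heq in HGa.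
    apply Rmult_eq_reg_r with (2 * Re (w a)); lra. }
  pose proof (strong_maximum_principle G a HGs HG Ha HGa1 0 unit_disc_0) as HG0.
  specialize (HGz 0 unit_disc_0).
  replace (1 - Cconj a * 0)%C with (RtoC 1) in HGz by ring.
  replace (0 - a)%C with (- a)%C in HGz by ring.
  apply (f_equal Cmod) in HGz.
  rewrite HG0, !Cmod_mult, HGa1, Cmod_opp, Cmod_1, Rmult_1_r, Rmult_1_l in HGz.
  assert (HFz' : forall z, unit_disc z ->
    (w z - w 0 = F z * z * (w z + Cconj (w 0)))%C).
  { intros z Hz. specialize (HFz z Hz).
    replace (1 - Cconj 0 * z)%C with (RtoC 1) in HFz
      by (apply injective_projections; simpl; ring).
    replace (w z - w 0)%C with ((w z - w 0) * 1)%C by ring. rewrite HFz. ring. }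
  assert (HFa1 : Cmod (F a) = 1).
  { pose proof (f_equal Cmod (HFz' a Ha)) as E.
    rewrite !Cmod_mult, Cmod_sub_sym, HGz in E.
    assert (Hc : Cmod (w a + Cconj (w 0)) = Cmod (w 0 + Cconj (w a))).
    { rewrite <- (Cmod_conj (w 0 + _)), Cplus_conj, Cconj_conj. f_equal. ring. }
    rewrite Hc in E.
    assert (0 < Cmod (w 0 + Cconj (w a))).
    { apply Cmod_gt_0, C_neq_0_of_Re. destruct (w 0), (w a).
      unfold Re in *. simpl in *. lra. }
    assert (0 < Cmod a) by (now apply Cmod_gt_0).
    assert (Hp : 0 < Cmod a * Cmod (w 0 + Cconj (w a))) by (now apply Rmult_lt_0_compat).
    apply Rmult_eq_reg_r with (Cmod a * Cmod (w 0 + Cconj (w a))); lra. }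
  exists (F a). split; [exact HFa1 |]. intros z Hz.
  rewrite <- (strong_maximum_principle F a HFs HF Ha HFa1 z Hz). now apply HFz'.
Qed.

(** * Unimodular numbers and the half-angle *)

Lemma expi_plus (a b : R) : expi (a + b) = (expi a * expi b)%C.
Proof.
  unfold expi. rewrite cos_plus, sin_plus.
  apply injective_projections; simpl; ring.
Qed.

Lemma expi_0 : expi 0 = RtoC 1.
Proof. unfold expi. now rewrite cos_0, sin_0. Qed.

Lemma Cconj_expi (a : R) : Cconj (expi a) = expi (- a).
Proof. unfold expi, Cconj. simpl. now rewrite cos_neg, sin_neg. Qed.

Lemma Cmod_expi (a : R) : Cmod (expi a) = 1.
Proof.
  unfold Cmod, expi. etransitivity; [apply f_equal | apply sqrt_1].
  pose proof (sin2_cos2 a) as H. unfold Rsqr in H. simpl. lra.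
Qed.

Lemma expi_inv (a : R) : (expi a * expi (- a))%C = RtoC 1.
Proof. rewrite <- expi_plus, Rplus_opp_r. apply expi_0. Qed.

Lemma expi_surjective (u : C) : Cmod u = 1 -> exists a : R, u = expi a.
Proof.
  intros Hu. pose proof (Cmod2_alt u) as H. rewrite Hu in H.
  destruct u as [x y]. unfold Re, Im in H. simpl in H.
  assert (Hx : -1 <= x <= 1) by nra.
  assert (Hs : sqrt (1 - x²) = Rabs y).
  { rewrite <- sqrt_Rsqr_abs. f_equal. unfold Rsqr. lra. }
  destruct (Rle_lt_dec 0 y) as [Hy | Hy].
  - exists (acos x). unfold expi. rewrite cos_acos, sin_acos, Hs by assumption.
    now rewrite Rabs_pos_eq.
  - exists (- acos x). unfold expi. rewrite cos_neg, sin_neg, cos_acos, sin_acos, Hs by assumption.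
    rewrite Rabs_left by assumption. now rewrite Ropp_involutive.
Qed.

Lemma cos_sin_quarter_turn (sg : R) : sg * sg = 1 ->
  cos (- (sg * (PI / 2))) = 0 /\ sin (- (sg * (PI / 2))) = - sg.
Proof.
  intros Hsg. assert (H : (sg - 1) * (sg + 1) = 0) by lra.
  apply Rmult_integral in H. destruct H as [H | H].
  - replace (- (sg * (PI / 2))) with (- (PI / 2)) by nra.
    rewrite cos_neg, sin_neg, cos_PI2, sin_PI2. lra.
  - replace (- (sg * (PI / 2))) with (PI / 2) by nra.
    rewrite cos_PI2, sin_PI2. lra.
Qed.

Lemma half_angle (l : R) : - PI / 2 < l < PI / 2 ->
  let t := tan (l / 2) in
  0 < cos l /\ t ^ 2 < 1 /\ cos l * (1 + t ^ 2) = 1 - t ^ 2 /\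
  sin l * (1 + t ^ 2) = 2 * t.
Proof.
  intros Hl t.
  assert (Hc : 0 < cos l) by (apply cos_gt_0; lra).
  assert (Hh : 0 < cos (l / 2)) by (apply cos_gt_0; lra).
  pose proof (sin2_cos2 (l / 2)) as H1. unfold Rsqr in H1.
  assert (E1 : cos l = cos (l / 2) * cos (l / 2) - sin (l / 2) * sin (l / 2)).
  { replace l with (l / 2 + l / 2) at 1 by field. apply cos_plus. }
  assert (E2 : sin l = 2 * sin (l / 2) * cos (l / 2)).
  { replace l with (l / 2 + l / 2) at 1 by field. rewrite sin_plus. ring. }
  assert (Ht : t * cos (l / 2) = sin (l / 2)) by (unfold t, tan; field; lra).
  assert (Ec : cos l * (1 + t ^ 2) = 1 - t ^ 2).
  { rewrite E1, <- Ht. rewrite <- Ht in H1.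
    replace ((cos (l / 2) * cos (l / 2) - t * cos (l / 2) * (t * cos (l / 2))) * (1 + t ^ 2))
      with ((t * cos (l / 2) * (t * cos (l / 2)) + cos (l / 2) * cos (l / 2)) * (1 - t ^ 2))
      by ring. rewrite H1. ring. }
  split; [exact Hc |]. split; [| split; [exact Ec |]].
  - pose proof (pow2_ge_0 t). nra.
  - rewrite E2, <- Ht. rewrite <- Ht in H1.
    replace (2 * (t * cos (l / 2)) * cos (l / 2) * (1 + t ^ 2))
      with (2 * t * (t * cos (l / 2) * (t * cos (l / 2)) + cos (l / 2) * cos (l / 2)))
      by ring. rewrite H1. ring.
Qed.

(** The hypothesis on (x, y) describes a disc in the right half-plane that lies
    strictly above the real axis and whose tangents from the origin have
    length 1; N is the modulus.  The largest cosine x / N over this disc is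
    attained only at the lower tangent point (K, S).  Indeed
    N^2 + 1 >= 2 N shows that the direction (X, Y) of (x, y) satisfies
    X c (1 + r^2) + Y s (1 - r^2) >= 1 - r^2, which cuts the unit circle along
    an arc with lower end (K, S); past this end the circle leaves the
    half-plane, as the slopes at (K, S) show. *)
Lemma tangent_point_extremal (c s r x y N : R) :
  0 < c -> c ^ 2 + s ^ 2 = 1 -> 0 < r < 1 -> 2 * r < (1 + r ^ 2) * s ->
  0 < N -> N ^ 2 = x ^ 2 + y ^ 2 ->
  (1 - r ^ 2) * (N ^ 2 + 1) <= 2 * x * c * (1 + r ^ 2) + 2 * y * s * (1 - r ^ 2) ->
  let D := 1 + r ^ 2 - 2 * r * s in
  0 < D /\
  x * D <= c * (1 - r ^ 2) * N /\
  (x * D = c * (1 - r ^ 2) * N ->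
     x * D = c * (1 - r ^ 2) /\ y * D = s * (1 + r ^ 2) - 2 * r).
Proof.
  intros Hc Hcs Hr Hrs HN HN2 Hdisc D.
  assert (Hs : 0 < s) by nra.
  assert (Hs1 : s < 1) by nra.
  assert (HD : 0 < D) by (unfold D; nra).
  assert (Hq : 0 < 1 - r ^ 2) by nra.
  set (X := x / N). set (Y := y / N).
  set (K := c * (1 - r ^ 2) / D). set (S := (s * (1 + r ^ 2) - 2 * r) / D).
  assert (HX : X * N = x) by (unfold X; field; lra).
  assert (HY : Y * N = y) by (unfold Y; field; lra).
  assert (HK : K * D = c * (1 - r ^ 2)) by (unfold K; field; lra).
  assert (HS : S * D = s * (1 + r ^ 2) - 2 * r) by (unfold S; field; lra).
  assert (HS0 : 0 < S) by (apply Rdiv_lt_0_compat; lra).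
  assert (HXY : X ^ 2 + Y ^ 2 = 1).
  { apply Rmult_eq_reg_r with (N ^ 2); [| nra].
    replace ((X ^ 2 + Y ^ 2) * N ^ 2) with ((X * N) ^ 2 + (Y * N) ^ 2) by ring.
    rewrite HX, HY. lra. }
  assert (Hc2 : c ^ 2 = 1 - s ^ 2) by lra.
  assert (HKS : K ^ 2 + S ^ 2 = 1).
  { apply Rmult_eq_reg_r with (D ^ 2); [| nra].
    replace ((K ^ 2 + S ^ 2) * D ^ 2) with ((K * D) ^ 2 + (S * D) ^ 2) by ring.
    rewrite HK, HS, Rpow_mult_distr, Hc2. unfold D. ring. }
  assert (HL : K * (c * (1 + r ^ 2)) + S * (s * (1 - r ^ 2)) = 1 - r ^ 2).
  { apply Rmult_eq_reg_r with D; [| lra].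
    replace ((K * (c * (1 + r ^ 2)) + S * (s * (1 - r ^ 2))) * D)
      with ((K * D) * (c * (1 + r ^ 2)) + (S * D) * (s * (1 - r ^ 2))) by ring.
    rewrite HK, HS.
    replace (c * (1 - r ^ 2) * (c * (1 + r ^ 2))) with (c ^ 2 * (1 - r ^ 4)) by ring.
    rewrite Hc2. unfold D. ring. }
  assert (HLX : 1 - r ^ 2 <= X * (c * (1 + r ^ 2)) + Y * (s * (1 - r ^ 2))).
  { apply Rmult_le_reg_r with (2 * N); [lra |].
    replace ((X * (c * (1 + r ^ 2)) + Y * (s * (1 - r ^ 2))) * (2 * N))
      with (2 * (X * N) * c * (1 + r ^ 2) + 2 * (Y * N) * s * (1 - r ^ 2)) by ring.
    rewrite HX, HY. pose proof (pow2_ge_0 (N - 1)). nra. }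
  assert (Huniq : K <= X -> X = K /\ Y = S).
  { intros HKX.
    assert (Hlin : K * (X - K) + S * (Y - S) <= 0).
    { pose proof (pow2_ge_0 (X - K)). pose proof (pow2_ge_0 (Y - S)). nra. }
    assert (Hlin2 : 0 <= (X - K) * (c * (1 + r ^ 2)) + (Y - S) * (s * (1 - r ^ 2))) by lra.
    (* the circle at (K, S) runs out of the half-plane: this determinant is negative *)
    assert (Hslope : S * (c * (1 + r ^ 2)) - K * (s * (1 - r ^ 2)) = - (2 * r * c)).
    { apply Rmult_eq_reg_r with D; [| lra].
      replace ((S * (c * (1 + r ^ 2)) - K * (s * (1 - r ^ 2))) * D)
        with ((S * D) * (c * (1 + r ^ 2)) - (K * D) * (s * (1 - r ^ 2))) by ring.
      rewrite HK, HS. unfold D. ring. }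
    assert (Hprod : 0 <= (X - K) * (- (2 * r * c))).
    { rewrite <- Hslope.
      assert (0 <= s * (1 - r ^ 2)) by nra.
      assert (0 <= S * ((X - K) * (c * (1 + r ^ 2)) + (Y - S) * (s * (1 - r ^ 2))))
        by (apply Rmult_le_pos; lra).
      nra. }
    assert (0 < 2 * r * c) by nra.
    assert (HXK : X = K) by nra.
    split; [exact HXK |].
    assert (0 < s * (1 - r ^ 2)) by nra.
    rewrite HXK in Hlin2, HXY. nra. }
  assert (HXK : X <= K).
  { apply Rnot_lt_le. intros H. destruct (Huniq ltac:(lra)). lra. }
  split; [exact HD |]. split.
  - rewrite <- HK, <- HX. apply Rmult_le_reg_r with (/ N).
    + now apply Rinv_0_lt_compat.
    + replace (X * N * D * / N) with (X * D) by (field; lra).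
      replace (K * D * N * / N) with (K * D) by (field; lra).
      apply Rmult_le_compat_r; lra.
  - intros E.
    assert (EX : X = K).
    { apply Rmult_eq_reg_r with (N * D); [| nra].
      replace (X * (N * D)) with ((X * N) * D) by ring. rewrite HX, E, <- HK. ring. }
    destruct (Huniq ltac:(lra)) as [_ EY].
    assert (HN1 : N = 1).
    { rewrite <- HX, <- HY, EX, EY in Hdisc.
      assert ((1 - r ^ 2) * (N ^ 2 + 1) <= (1 - r ^ 2) * (2 * N)).
      { eapply Rle_trans; [exact Hdisc |]. right.
        transitivity (2 * N * (K * (c * (1 + r ^ 2)) + S * (s * (1 - r ^ 2)))); [ring |].
        rewrite HL. ring. }
      assert (N ^ 2 + 1 <= 2 * N) by (apply Rmult_le_reg_l with (1 - r ^ 2); assumption).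
      pose proof (pow2_ge_0 (N - 1)). nra. }
    rewrite HN1, Rmult_1_r in E. split; [exact E |].
    rewrite <- HY, EY, HN1, Rmult_1_r. exact HS.
Qed.

(** * The largest cosine of the argument in the disc of possible values *)

(** Since s = 2 t / (1 + t^2) and x / (1 + x^2) increases on [0, 1], comparing
    r with t is comparing 2 r / (1 + r^2) with s. *)
Lemma tan_half_threshold (r t s : R) :
  0 < r < 1 -> t ^ 2 < 1 -> s * (1 + t ^ 2) = 2 * t ->
  r < t -> 2 * r < (1 + r ^ 2) * s.
Proof.
  intros Hr Ht Hs H.
  assert (Ht1 : t < 1) by nra.
  assert (0 < (t - r) * (1 - r * t)) by (apply Rmult_lt_0_compat; nra).
  pose proof (pow2_ge_0 t).
  apply Rmult_lt_reg_r with (1 + t ^ 2); [lra |].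
  replace ((1 + r ^ 2) * s * (1 + t ^ 2)) with ((1 + r ^ 2) * (s * (1 + t ^ 2))) by ring.
  rewrite Hs. nra.
Qed.

(** In the case r < |tan (l / 2)| the two signs of l are mirror images; [sg] is
    the sign of l, and both prescribed values of the extremal angle are
    l - sg pi / 2. *)
Lemma extremal_sign (l r : R) :
  - PI / 2 < l < PI / 2 -> 0 < r < 1 -> r < Rabs (tan (l / 2)) ->
  exists sg : R, sg * sg = 1 /\ Rabs (sin l) = sg * sin l /\
    2 * r < (1 + r ^ 2) * (sg * sin l) /\
    extremal_angle l r (- (sg * (PI / 2)) + l).
Proof.
  intros Hl Hr Hlt. destruct (half_angle l Hl) as [_ [Ht [_ Hs]]].
  unfold extremal_angle. set (t := tan (l / 2)) in *.
  assert (Hpos : 0 <= 1 + t ^ 2) by (pose proof (pow2_ge_0 t); lra).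
  destruct (Rle_lt_dec 0 t) as [H0 | H0].
  - rewrite (Rabs_pos_eq t) in Hlt |- * by assumption.
    pose proof (tan_half_threshold r t (sin l) Hr Ht Hs Hlt).
    exists 1. repeat split; try lra.
    rewrite Rabs_pos_eq; [lra |]. nra.
  - rewrite (Rabs_left t) in Hlt |- * by assumption.
    pose proof (tan_half_threshold r (- t) (- sin l) Hr ltac:(nra) ltac:(nra) Hlt).
    exists (-1). repeat split; try lra.
    rewrite Rabs_left; [lra |]. nra.
Qed.

(** Largest value of cos (arg u) on the disc of all possible values u of
    e^(il) p at points of modulus r: it is 1 exactly when that disc meets the
    real axis, which is the case r >= |tan (l / 2)|. *)
Definition max_cos_arg (l r : R) : R :=
  if Rlt_dec r (Rabs (tan (l / 2)))
  then cos l * (1 - r ^ 2) / (1 + r ^ 2 - 2 * r * Rabs (sin l))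
  else 1.

(** The pseudo-hyperbolic disc around e^(il) rewritten as a Euclidean one. *)
Lemma half_plane_disc_position (l r : R) (u : C) :
  Cmod (u - expi l) <= r * Cmod (u + Cconj (expi l)) -> 0 <= r ->
  (1 - r ^ 2) * (Cmod u ^ 2 + 1) <=
  2 * Re u * cos l * (1 + r ^ 2) + 2 * Im u * sin l * (1 - r ^ 2).
Proof.
  intros H Hr.
  assert (H2 : Cmod (u - expi l) ^ 2 <= (r * Cmod (u + Cconj (expi l))) ^ 2).
  { apply pow_incr. split; [apply Cmod_ge_0 | exact H]. }
  rewrite Rpow_mult_distr, !Cmod2_alt in H2. rewrite Cmod2_alt.
  pose proof (sin2_cos2 l) as E. unfold Rsqr in E.
  destruct u as [x y]. unfold Re, Im, expi in *. simpl in *.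
  set (c := cos l) in *. set (s := sin l) in *.
  assert (Hs2 : s * s = 1 - c * c) by lra.
  match type of H2 with ?a <= ?b => assert (Hba : 0 <= b - a) by lra end.
  match goal with |- ?a <= ?b => assert (Hz : 0 <= b - a); [| lra] end.
  replace (r * (r * 1)) with (r * r) in * by ring.
  eapply Rle_trans; [exact Hba |]. right.
  transitivity (2 * x * c * (1 + r * r) + 2 * y * s * (1 - r * r)
    - (1 - r * r) * (x * x + y * y + c * c + s * s)); [ring |].
  rewrite Hs2. ring.
Qed.

(** The multiplier om is the point r e^(i alpha) at which the extremal
    function is evaluated.  When the bound is attained, u is the tangent point
    or a positive real number, and solving
    u - e^(il) = om (u + e^(-il)) for om gives the angle. *)
Lemma max_cos_arg_bound (l r : R) (u : C) :
  - PI / 2 < l < PI / 2 -> 0 < r < 1 -> 0 < Re u ->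
  Cmod (u - expi l) <= r * Cmod (u + Cconj (expi l)) ->
  Re u <= max_cos_arg l r * Cmod u /\
  (Re u = max_cos_arg l r * Cmod u ->
   forall om : C, Cmod om = r ->
     (u - expi l = om * (u + Cconj (expi l)))%C ->
     exists alpha : R, extremal_angle l r alpha /\ om = (r * expi alpha)%C).
Proof.
  intros Hl Hr Hu Hdisc.
  destruct (half_angle l Hl) as [Hc _].
  pose proof (sin2_cos2 l) as E. unfold Rsqr in E.
  assert (Hne : (u + Cconj (expi l))%C <> 0).
  { apply C_neq_0_of_Re. destruct u. unfold Re, expi in *. simpl in *. lra. }
  assert (HN : 0 < Cmod u) by (apply Cmod_gt_0; now apply C_neq_0_of_Re).
  pose proof (half_plane_disc_position l r u Hdisc ltac:(lra)) as Hpos.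
  unfold max_cos_arg.
  destruct (Rlt_dec r (Rabs (tan (l / 2)))) as [Hlt | Hge].
  - destruct (extremal_sign l r Hl Hr Hlt) as [sg [Hsg [Habs [Hrs Hang]]]].
    rewrite Habs.
    destruct (tangent_point_extremal (cos l) (sg * sin l) r (Re u) (sg * Im u) (Cmod u))
      as [HD [Hle Heq]]; try assumption.
    + replace ((sg * sin l) ^ 2) with ((sg * sg) * (sin l * sin l)) by ring.
      rewrite Hsg. lra.
    + rewrite Cmod2_alt. replace ((sg * Im u) ^ 2) with ((sg * sg) * (Im u) ^ 2) by ring.
      rewrite Hsg. ring.
    + replace (2 * (sg * Im u) * (sg * sin l) * (1 - r ^ 2))
        with ((sg * sg) * (2 * Im u * sin l * (1 - r ^ 2))) by ring.
      rewrite Hsg. lra.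
    + set (D := 1 + r ^ 2 - 2 * r * (sg * sin l)) in *.
      split.
      * apply Rmult_le_reg_r with D; [exact HD |].
        replace (cos l * (1 - r ^ 2) / D * Cmod u * D)
          with (cos l * (1 - r ^ 2) * Cmod u) by (field; lra). exact Hle.
      * intros Ex om Hom Eom.
        destruct Heq as [Hx Hy]; [rewrite Ex; field; lra |].
        exists (- (sg * (PI / 2)) + l). split; [exact Hang |].
        assert (Hexp : expi (- (sg * (PI / 2)) + l) = (sg * sin l, - (sg * cos l))).
        { destruct (cos_sin_quarter_turn sg Hsg) as [H1 H2].
          unfold expi. rewrite cos_plus, sin_plus, H1, H2.
          f_equal; ring. }
        rewrite Hexp. set (v := (sg * sin l, - (sg * cos l)) : C).
        (* om and r v are two solutions of the same linear equation *)
        assert (Hz : ((om - RtoC r * v) * (u + Cconj (expi l)))%C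
                     = RtoC 0).
        { replace ((om - RtoC r * v) * (u + Cconj (expi l)))%C
            with (om * (u + Cconj (expi l))
                  - RtoC r * v * (u + Cconj (expi l)))%C by ring.
          rewrite <- Eom.
          assert (Hy' : Im u * D = (sin l) * (1 + r ^ 2) - 2 * r * sg).
          { replace (Im u * D) with (sg * sg * (Im u * D)) by (rewrite Hsg; ring).
            replace (sg * sg * (Im u * D)) with (sg * (sg * Im u * D)) by ring.
            rewrite Hy. replace (sg * (sg * sin l * (1 + r ^ 2) - 2 * r))
              with (sg * sg * (sin l * (1 + r ^ 2)) - 2 * r * sg) by ring.
            rewrite Hsg. ring. }
          destruct u as [x y]. unfold Re, Im, expi in *. simpl fst in *. simpl snd in *.
          set (c := cos l) in *. set (s := sin l) in *.
          unfold v. apply injective_projections; simpl.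
          - apply Rmult_eq_reg_r with D; [| lra].
            transitivity ((x * D) * (1 - r * (sg * s)) - (y * D) * (r * (sg * c)) - c * D
              - r * sg * s * c * D + r * sg * c * s * D); [ring |].
            rewrite Hx, Hy'. unfold D.
            transitivity (2 * c * r ^ 2 * (sg * sg - 1)); [ring | rewrite Hsg; ring].
          - apply Rmult_eq_reg_r with D; [| lra].
            transitivity ((y * D) * (1 - r * (sg * s)) + (x * D) * (r * (sg * c)) - s * D
              + r * sg * (c * c + s * s) * D); [ring |].
            rewrite Hx, Hy'. replace (c * c + s * s) with 1 by lra.
            replace (c * (1 - r ^ 2) * (r * (sg * c)))
              with ((c * c) * ((1 - r ^ 2) * (r * sg))) by ring.
            replace (c * c) with (1 - s * s) by lra. unfold D.
            ring. }
        apply NNPP. intros Hn. apply Csub_neq_0 in Hn.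
        exact (Cmult_neq_0 _ _ Hn Hne Hz).
  - split.
    + rewrite Rmult_1_l. eapply Rle_trans; [apply Rle_abs | apply re_le_Cmod].
    + intros Ex om Hom Eom. rewrite Rmult_1_l in Ex.
      assert (Him : Im u = 0).
      { pose proof (Cmod2_alt u) as H2. rewrite <- Ex in H2. nra. }
      destruct (expi_surjective (om * / RtoC r)%C) as [alpha Ha].
      { rewrite Cmod_mult, Hom, Cmod_inv, Cmod_R, Rabs_pos_eq; try lra.
        - field. lra.
        - intros H. apply RtoC_inj in H. lra. }
      assert (Hr0 : RtoC r <> 0) by (intros H; apply RtoC_inj in H; lra).
      assert (Eo : om = (RtoC r * expi alpha)%C).
      { rewrite <- Ha. field. exact Hr0. }
      exists alpha. split; [| exact Eo].
      assert (Hge' : Rabs (tan (l / 2)) <= r) by lra.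
      pose proof (Rle_abs (tan (l / 2))). pose proof (Rle_abs (- tan (l / 2))) as H'.
      rewrite Rabs_Ropp in H'.
      split; [lra |]. split; [lra |]. intros _.
      rewrite Eo in Eom. destruct u as [x y]. unfold Re, Im in *. simpl in Him. subst y.
      unfold expi in Eom. rewrite sin_minus.
      pose proof (sin2_cos2 alpha) as E2. unfold Rsqr in E2.
      set (c := cos l) in *. set (s := sin l) in *.
      set (a := cos alpha) in *. set (b := sin alpha) in *.
      pose proof (f_equal fst Eom) as F1. pose proof (f_equal snd Eom) as F2.
      simpl in F1, F2.
      assert (F1' : x * (1 - r * a) - c - r * (a * c + b * s) = 0) by lra.
      assert (F2' : - (x * (r * b)) - s - r * (b * c - a * s) = 0) by lra.
      (* the imaginary part of x |1 - r e^(i alpha)|^2, which eliminates x *)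
      assert (HH : (x * (1 - r * a) - c - r * (a * c + b * s)) * (r * b)
                 + (- (x * (r * b)) - s - r * (b * c - a * s)) * (1 - r * a) = 0).
      { rewrite F1', F2'. ring. }
      assert (r ^ 2 * s * (a * a + b * b - 1) = 0).
      { replace (a * a + b * b) with 1 by lra. ring. }
      nra.
Qed.

Lemma M_max_cos_arg (l r : R) :
  - PI / 2 < l < PI / 2 -> 0 < r < 1 ->
  M l r = 2 * r * max_cos_arg l r / (1 - r ^ 2).
Proof.
  intros Hl Hr. unfold M, max_cos_arg.
  destruct (Rlt_dec r (Rabs (tan (l / 2)))) as [Hlt | Hge].
  - assert (Rabs (sin l) <= 1).
    { apply Rabs_le. pose proof (SIN_bound l). lra. }
    field. split; nra.
  - now rewrite Rmult_1_r.
Qed.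

(** * The extremal functions *)

Lemma C_derive_scal (k : C) (f : C -> C) (a : C) :
  smooth_on_disc f -> unit_disc a -> C_derive (fun z => k * f z)%C a = (k * C_derive f a)%C.
Proof.
  intros Hf Ha. destruct (smooth_quotient f a Hf Ha) as [g [Hg [Hga Hgz]]].
  rewrite <- Hga. apply (C_derive_jet _ (fun z => k * g z)%C).
  - apply jet_mult; [apply jet_const | now apply Hg].
  - apply near_all. intros z. rewrite (Hgz z). ring.
Qed.

Lemma Cmod_polar (r theta : R) : 0 <= r -> Cmod (r * expi theta) = r.
Proof. intros H. rewrite Cmod_mult, Cmod_expi, Cmod_R, Rabs_pos_eq by assumption. ring. Qed.

Lemma disc_1_plus_neq_0 (u z : C) :
  Cmod u = 1 -> unit_disc z -> (1 + u * z)%C <> 0.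
Proof.
  intros Hu Hz E. unfold unit_disc in Hz.
  assert (H : Cmod (u * z) = 1).
  { replace (u * z)%C with (- (1) + (1 + u * z))%C by ring.
    rewrite E, Cplus_0_r. apply Cmod_m1. }
  rewrite Cmod_mult, Hu in H. lra.
Qed.

Lemma disc_1_minus_neq_0 (u z : C) :
  Cmod u = 1 -> unit_disc z -> (1 - u * z)%C <> 0.
Proof.
  intros Hu Hz. replace (1 - u * z)%C with (1 + (- u) * z)%C by ring.
  apply disc_1_plus_neq_0; [now rewrite Cmod_opp | exact Hz].
Qed.

Lemma extremal_derivative (l : R) (k a : C) (p : C -> C) :
  Cmod k = 1 -> unit_disc a ->
  (forall z, unit_disc z -> p z = p_extremal l (k * z)%C) ->
  (a * C_derive p a / p a =
   k * a * (1 + expi (- (2 * l))) /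
     ((1 - k * a) * (1 + expi (- (2 * l)) * (k * a))))%C /\
  (1 - k * a <> 0)%C /\ (1 + expi (- (2 * l)) * (k * a) <> 0)%C.
Proof.
  intros Hk Ha Hp.
  assert (H1 : forall z, unit_disc z -> (1 - k * z)%C <> 0)
    by (intros z Hz; now apply disc_1_minus_neq_0).
  set (e := expi (- (2 * l))).
  assert (H2 : forall z, unit_disc z -> (1 + e * (k * z))%C <> 0).
  { intros z Hz. rewrite Cmult_assoc. apply disc_1_plus_neq_0; [| exact Hz].
    unfold e. rewrite Cmod_mult, Cmod_expi, Hk. ring. }
  split; [| split; auto].
  rewrite (C_derive_jet p (fun z => k * (1 + e) * / (1 - k * a) * / (1 - k * z))%C).
  - rewrite (Hp a Ha). unfold p_extremal. fold e. field. auto.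
  - apply jet_mult; [apply jet_const |].
    apply (jet_inv 1 (fun z => 1 - k * z)%C); [| now apply H1].
    apply jet_minus; [apply jet_const |]. apply jet_mult; [apply jet_const | apply jet_id].
  - generalize (unit_disc_near a Ha). apply near_imp. intros z Hz.
    rewrite (Hp a Ha), (Hp z Hz). unfold p_extremal. fold e. field. auto.
Qed.

(** With alpha = l + b the squares of the two moduli are
    1 + r^2 + 2 r s sin b -/+ 2 r c cos b.  In the first case cos b = 0 and
    they coincide; in the second the condition on sin b turns their product
    into the square of (1 - r^2) c. *)
Lemma extremal_value (l r alpha : R) :
  - PI / 2 < l < PI / 2 -> 0 < r < 1 -> extremal_angle l r alpha ->
  let om := (r * expi alpha)%C in
  r * (2 * cos l) / (Cmod (1 - om) * Cmod (1 + expi (- (2 * l)) * om)) = M l r.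
Proof.
  intros Hl Hr [A1 [A2 A3]] om.
  destruct (half_angle l Hl) as [Hc _].
  pose proof (sin2_cos2 l) as E. unfold Rsqr in E.
  set (b := alpha - l). set (c := cos l) in *. set (s := sin l) in *.
  pose proof (sin2_cos2 b) as Eb. unfold Rsqr in Eb.
  assert (HA : Cmod (1 - om) ^ 2 = 1 + r ^ 2 - 2 * r * (c * cos b - s * sin b)).
  { unfold om. rewrite Cmod2_alt. unfold expi, Re, Im. simpl.
    replace (c * cos b - s * sin b) with (cos alpha)
      by (unfold c, s, b; rewrite <- cos_plus; f_equal; ring).
    pose proof (sin2_cos2 alpha) as H. unfold Rsqr in H.
    transitivity (1 - 2 * r * cos alpha
      + r * r * (sin alpha * sin alpha + cos alpha * cos alpha)); [ring |].
    rewrite H. ring. }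
  assert (HB : Cmod (1 + expi (- (2 * l)) * om) ^ 2
     = 1 + r ^ 2 + 2 * r * (c * cos b + s * sin b)).
  { replace (expi (- (2 * l)) * om)%C with (RtoC r * expi (b - l))%C.
    - rewrite Cmod2_alt. unfold expi, Re, Im. simpl.
      replace (c * cos b + s * sin b) with (cos (b - l))
        by (rewrite cos_minus; unfold c, s; ring).
      pose proof (sin2_cos2 (b - l)) as H. unfold Rsqr in H.
      transitivity (1 + 2 * r * cos (b - l)
        + r * r * (sin (b - l) * sin (b - l) + cos (b - l) * cos (b - l))); [ring |].
      rewrite H. ring.
    - unfold om. replace (b - l) with (- (2 * l) + alpha) by (unfold b; ring).
      rewrite expi_plus. ring. }
  assert (Hprod : forall Q, 0 < Q ->
    Cmod (1 - om) ^ 2 * Cmod (1 + expi (- (2 * l)) * om) ^ 2 = Q ^ 2 ->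
    Cmod (1 - om) * Cmod (1 + expi (- (2 * l)) * om) = Q).
  { intros Q HQ H. rewrite <- Rpow_mult_distr in H.
    apply Rsqr_inj; [apply Rmult_le_pos; apply Cmod_ge_0 | lra |].
    unfold Rsqr. lra. }
  assert (Hs1 : Rabs s <= 1).
  { apply Rabs_le. pose proof (SIN_bound l). unfold s. lra. }
  unfold M. fold c s.
  destruct (Rlt_dec r (Rabs (tan (l / 2)))) as [Hlt | Hge].
  - destruct (extremal_sign l r Hl Hr Hlt) as [sg [Hsg [Habs [Hrs [B1 [B2 _]]]]]].
    assert (Halpha : alpha = - (sg * (PI / 2)) + l).
    { destruct (Rle_lt_dec 0 (tan (l / 2))) as [H | H].
      - rewrite Rabs_pos_eq in Hlt by assumption. rewrite A2, B2; auto.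
      - rewrite Rabs_left in Hlt by assumption. rewrite A1, B1; auto. }
    assert (Hcs : cos b = 0 /\ sin b = - sg).
    { unfold b. rewrite Halpha.
      replace (- (sg * (PI / 2)) + l - l) with (- (sg * (PI / 2))) by ring.
      now apply cos_sin_quarter_turn. }
    destruct Hcs as [Hcb Hsb].
    fold s in Habs. rewrite (Hprod (1 + r ^ 2 - 2 * r * Rabs s)).
    + field. nra.
    + nra.
    + rewrite HA, HB, Hcb, Hsb, Habs. ring.
  - specialize (A3 ltac:(lra)). fold b s in A3.
    rewrite (Hprod ((1 - r ^ 2) * c)).
    + field. split; nra.
    + apply Rmult_lt_0_compat; nra.
    + rewrite HA, HB.
      transitivity ((1 + r ^ 2 + s * (2 * r * sin b)) ^ 2
        - 4 * r ^ 2 * (c * c) * (cos b * cos b)); [ring |].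
      replace (4 * r ^ 2 * (c * c) * (cos b * cos b))
        with ((c * c) * (4 * r ^ 2 - (2 * r * sin b) ^ 2))
        by (replace (cos b * cos b) with (1 - sin b * sin b) by lra; ring).
      rewrite A3.
      replace (s * (- (1 + r ^ 2) * s)) with (- (1 + r ^ 2) * (s * s)) by ring.
      replace ((- (1 + r ^ 2) * s) ^ 2) with ((1 + r ^ 2) ^ 2 * (s * s)) by ring.
      replace (s * s) with (1 - c * c) by lra. ring.
Qed.

Lemma Cmod_1_plus_expi (l : R) : 0 < cos l -> Cmod (1 + expi (- (2 * l))) = 2 * cos l.
Proof.
  intros Hc. replace (1 + expi (- (2 * l)))%C with (RtoC (2 * cos l) * expi (- l))%C.
  - rewrite Cmod_mult, Cmod_expi, Cmod_R, Rabs_pos_eq; lra.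
  - replace (RtoC (2 * cos l)) with (expi l + expi (- l))%C.
    + replace (- (2 * l)) with (- l + - l) by ring. rewrite expi_plus.
      rewrite Cmult_plus_distr_r, expi_inv. ring.
    + unfold expi. rewrite cos_neg, sin_neg.
      apply injective_projections; simpl; ring.
Qed.

(** Solves the Cayley transform equation of e^(il) w for w. *)
Lemma p_extremal_of_identity (l : R) (v w : C) :
  (1 - v)%C <> 0 ->
  (expi l * w - expi l = v * (expi l * w + Cconj (expi l)))%C ->
  w = p_extremal l v.
Proof.
  intros Hv H. unfold p_extremal. rewrite Cconj_expi in H.
  assert (H2 : (expi l * (w * (1 - v)) = expi l * (1 + expi (- (2 * l)) * v))%C).
  { replace (- (2 * l)) with (- l + - l) by ring. rewrite expi_plus.
    replace (expi l * (1 + expi (- l) * expi (- l) * v))%C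
      with (expi l + v * expi (- l) * (expi l * expi (- l)))%C by ring.
    rewrite expi_inv.
    replace (expi l * (w * (1 - v)))%C
      with ((expi l * w - expi l) + expi l - v * (expi l * w))%C by ring.
    rewrite H. ring. }
  assert (H3 : (w * (1 - v) = 1 + expi (- (2 * l)) * v)%C).
  { replace (w * (1 - v))%C with (expi (- l) * (expi l * (w * (1 - v))))%C.
    - rewrite H2, Cmult_assoc, (Cmult_comm (expi (- l))), expi_inv. ring.
    - rewrite Cmult_assoc, (Cmult_comm (expi (- l))), expi_inv. ring. }
  rewrite <- H3. field. exact Hv.
Qed.

Theorem theorem6 (lambda : R) (hlambda : - PI / 2 < lambda < PI / 2)
    (p : C -> C) (hp : class_P lambda p) :
  (forall z : C, unit_disc z ->
     Cmod (z * C_derive p z / p z)%C <= M lambda (Cmod z)) /\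
  (forall r theta : R, 0 < r < 1 ->
     let z0 : C := (r * expi theta)%C in
     Cmod (z0 * C_derive p z0 / p z0)%C = M lambda r <->
     exists alpha : R, extremal_angle lambda r alpha /\
       forall z : C, unit_disc z ->
         p z = p_extremal lambda (expi (alpha - theta) * z)%C).
Proof.
  destruct hp as [[Han Hp0] Hpos].
  pose proof (analytic_smooth p Han) as Hps.
  set (w := fun z => (expi lambda * p z)%C).
  assert (Hw : smooth_on_disc w).
  { intros c Hc n. apply jet_mult; [apply jet_const | now apply Hps]. }
  assert (Hw0 : w 0 = expi lambda) by (unfold w; rewrite Hp0; ring).
  assert (Hpos' : forall z, unit_disc z -> 0 < Re (w z)) by exact Hpos.
  assert (Hmodw : forall z, Cmod (p z) = Cmod (w z)).
  { intros z. unfold w. rewrite Cmod_mult, Cmod_expi. ring. }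
  assert (Hder : forall z, unit_disc z -> Cmod (C_derive p z) = Cmod (C_derive w z)).
  { intros z Hz. unfold w. rewrite C_derive_scal, Cmod_mult, Cmod_expi by assumption. ring. }
  assert (HNpos : forall z, unit_disc z -> 0 < Cmod (w z)).
  { intros z Hz. apply Cmod_gt_0, C_neq_0_of_Re. now apply Hpos'. }
  assert (Hlhs : forall z, unit_disc z -> Cmod (z * C_derive p z / p z)
     = Cmod z * Cmod (C_derive w z) / Cmod (w z)).
  { intros z Hz. pose proof (HNpos z Hz) as HN.
    rewrite Cmod_div, Cmod_mult, Hder, Hmodw; [reflexivity | exact Hz |].
    apply Cmod_gt_0. now rewrite Hmodw. }
  assert (Hkey : forall z, unit_disc z -> 0 < Cmod z ->
     Cmod (C_derive w z) * (1 - Cmod z ^ 2) <= 2 * Re (w z) /\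
     Re (w z) <= max_cos_arg lambda (Cmod z) * Cmod (w z) /\
     (Re (w z) = max_cos_arg lambda (Cmod z) * Cmod (w z) ->
      forall om : C, Cmod om = Cmod z ->
       (w z - expi lambda = om * (w z + Cconj (expi lambda)))%C ->
       exists alpha : R, extremal_angle lambda (Cmod z) alpha /\
         om = (Cmod z * expi alpha)%C)).
  { intros z Hz Hz0. split; [now apply half_plane_gradient |].
    apply max_cos_arg_bound; auto. rewrite <- Hw0. now apply half_plane_location. }
  split.
  - intros z Hz. destruct (Rle_lt_or_eq_dec 0 (Cmod z) (Cmod_ge_0 z)) as [Hz0 | Hz0].
    + rewrite Hlhs by exact Hz.
      rewrite M_max_cos_arg; [| exact hlambda | split; assumption].
      destruct (Hkey z Hz Hz0) as [K1 [K2 _]]. pose proof (HNpos z Hz) as HN.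
      pose proof (Cmod_lt_1_sqr z Hz) as Hr2.
      apply Rmult_le_reg_r with (Cmod (w z) * (1 - Cmod z ^ 2)).
      { apply Rmult_lt_0_compat; lra. }
      replace (Cmod z * Cmod (C_derive w z) / Cmod (w z) * (Cmod (w z) * (1 - Cmod z ^ 2)))
        with (Cmod z * (Cmod (C_derive w z) * (1 - Cmod z ^ 2))) by (field; lra).
      replace (2 * Cmod z * max_cos_arg lambda (Cmod z) / (1 - Cmod z ^ 2)
        * (Cmod (w z) * (1 - Cmod z ^ 2)))
        with (Cmod z * (2 * (max_cos_arg lambda (Cmod z) * Cmod (w z)))) by (field; lra).
      apply Rmult_le_compat_l; lra.
    + rewrite Hlhs by exact Hz. rewrite <- Hz0. unfold M.
      right. destruct (Rlt_dec _ _); unfold Rdiv; ring.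
  - intros r theta Hr z0.
    assert (Hz0r : Cmod z0 = r) by (apply Cmod_polar; lra).
    assert (Hz0 : unit_disc z0) by (unfold unit_disc; lra).
    assert (Hrot : forall alpha, (expi (alpha - theta) * z0 = r * expi alpha)%C).
    { intros alpha. unfold z0. replace (expi alpha) with (expi (alpha - theta) * expi theta)%C.
      - ring.
      - rewrite <- expi_plus. f_equal. ring. }
    split.
    + intros Heq. rewrite Hlhs, M_max_cos_arg in Heq by assumption.
      destruct (Hkey z0 Hz0 ltac:(lra)) as [K1 [K2 K3]].
      pose proof (HNpos z0 Hz0) as HN. pose proof (Cmod_lt_1_sqr z0 Hz0) as Hr2.
      rewrite Hz0r in *.
      assert (Hboth : Cmod (C_derive w z0) * (1 - r ^ 2)
                      = 2 * (max_cos_arg lambda r * Cmod (w z0))).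
      { apply Rmult_eq_reg_l with r; [| lra].
        transitivity (r * Cmod (C_derive w z0) / Cmod (w z0)
          * (Cmod (w z0) * (1 - r ^ 2))); [field; lra |].
        rewrite Heq. field. lra. }
      destruct (half_plane_gradient_rigidity w z0 Hw Hpos' Hz0) as [k [Hk Hkz]].
      * apply Cmod_gt_0. lra.
      * rewrite Hz0r. lra.
      * rewrite Hw0 in Hkz.
        destruct (K3 ltac:(lra) (k * z0)%C) as [alpha [Hal Eal]].
        { rewrite Cmod_mult, Hk, Hz0r. ring. }
        { now apply Hkz. }
        exists alpha. split; [exact Hal |].
        assert (Ek : k = expi (alpha - theta)).
        { rewrite <- Hrot in Eal.
          assert (Hzn : z0 <> 0) by (apply Cmod_gt_0; lra).
          replace k with (k * z0 * / z0)%C by (field; exact Hzn).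
          rewrite Eal. field. exact Hzn. }
        intros z Hz. rewrite <- Ek. apply p_extremal_of_identity.
        -- now apply disc_1_minus_neq_0.
        -- now apply Hkz.
    + intros [alpha [Hal Hpz]].
      destruct (half_angle lambda hlambda) as [Hc _].
      destruct (extremal_derivative lambda (expi (alpha - theta)) z0 p
        (Cmod_expi _) Hz0 Hpz) as [E [N1 N2]].
      rewrite E. rewrite Hrot in *.
      rewrite Cmod_div, !Cmod_mult, Cmod_1_plus_expi, Cmod_expi, Cmod_R, Rabs_pos_eq;
        try lra.
      * rewrite <- (extremal_value lambda r alpha hlambda Hr Hal).
        rewrite Rmult_1_r. reflexivity.
      * now apply Cmult_neq_0.
Qed.
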